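(* The map $(c,\mathbf t)\mapsto$ (distribution of $c+\mathcal S_{\mathbf t}$) is a bijection from $\mathbb R\times\widetilde\ell_2$ onto the set of generalized uniform sum distributions. In particular, if $\mathbf t,\mathbf u\in\widetilde\ell_2$ with $\mathbf t\ne\mathbf u$, then $\mathcal S_{\mathbf t}$ and $\mathcal S_{\mathbf u}$ have different distributions. Furthermore, for nonzero $\mathbf t,\mathbf u\in\widetilde\ell_2$, $\mathcal S_{\mathbf t}^*$ and $\mathcal S_{\mathbf u}^*$ have the same distribution if and only if $\mathbf t$ and $\mathbf u$ differ by a scalar multiple.
   Context: A generalized uniform sum distribution is the distribution of a random variable with finite mean and variance given as a countable sum of independent continuous uniform random variables. $\widetilde\ell_2=\{\mathbf t=(t_1,t_2,\dots):t_1\ge t_2\ge\dots\ge0,\ \sum_kt_k^2<\infty\}$. For $\mathbf t\in\widetilde\ell_2$, $\mathcal S_{\mathbf t}=\sum_{k\ge1}\mathcal U[-t_k/2,t_k/2]$ with independent summands (this converges almost surely). $\mathcal X^*=(\mathcal X-\mu)/\sigma$ denotes standardization. *)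

(* Defs.v *)
From HB Require Import structures.
From mathcomp Require Import all_boot all_order all_algebra finmap.
From mathcomp Require Import all_classical all_reals all_analysis.

Set Implicit Arguments.
Unset Strict Implicit.
Unset Printing Implicit Defensive.

Import Order.TTheory GRing.Theory Num.Theory.
Import numFieldNormedType.Exports.

Local Open Scope classical_set_scope.
Local Open Scope ring_scope.

Definition borel_set (R : realType) : Type := {A : set R | measurable A}.

(* A library measure is a total function on [set T] whose values outside the
   sigma-algebra are unconstrained, so distributions are compared as functions
   on Borel sets only. *)
Definition law (R : realType) (d : measure_display) (T : measurableType d)
    (P : probability T R) (X : T -> R) : borel_set R -> \bar R :=
  fun A => pushforward P X (sval A).

Definition mutually_independent (R : realType) (d : measure_display)
    (T : measurableType d) (P : probability T R) (X : nat -> {RV P >-> R}) :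
    Prop :=
  forall (J : {fset nat}) (A : nat -> set R), (forall k, measurable (A k)) ->
    P (\big[setI/setT]_(k <- J) (X k @^-1` A k)) =
    (\prod_(k <- J) P (X k @^-1` A k))%E.

(* U[a, a] is the point mass at a; this case is needed because entries of t
   may vanish. *)
Definition uniform_on (R : realType) (d : measure_display)
    (T : measurableType d) (P : probability T R) (a b : R)
    (X : {RV P >-> R}) : Prop :=
  [/\ a <= b,
      forall (ab : a < b) (A : set R), measurable A ->
        distribution P X A = uniform_prob ab A &
      a = b -> forall A : set R, measurable A ->
        distribution P X A = \d_a A].

(* S is (a version of) the almost sure sum of independent U[a_k, b_k].
   Finite sums are the case a_k = b_k = 0 for all large k. *)
Definition is_uniform_sum (R : realType) (d : measure_display)
    (T : measurableType d) (P : probability T R) (a b : nat -> R)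
    (S : {RV P >-> R}) : Prop :=
  exists X : nat -> {RV P >-> R},
    [/\ mutually_independent X,
        forall k, uniform_on (a k) (b k) (X k) &
        {ae P, forall w, (fun n => \sum_(0 <= k < n) X k w) @ \oo --> S w}].

Definition generalized_uniform_sum_laws (R : realType) :
    set (borel_set R -> \bar R) :=
  [set m | exists (d : measure_display) (T : measurableType d)
             (P : probability T R) (a b : nat -> R) (S : {RV P >-> R}),
     [/\ is_uniform_sum a b S,
         P.-integrable [set: T] (EFin \o S),
         ('V_P[S] < +oo)%E &
         m = law P S]].

(* t_1, t_2, ... is indexed from 0. *)
Definition l2_tilde (R : realType) : set (nat -> R) :=
  [set t : nat -> R | [/\ forall k, t k.+1 <= t k,
               forall k, 0 <= t k &
               cvgn (series (fun k => t k ^+ 2))]].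

Definition is_calS (R : realType) (d : measure_display) (T : measurableType d)
    (P : probability T R) (t : nat -> R) (S : {RV P >-> R}) : Prop :=
  is_uniform_sum (fun k => - (t k / 2)) (fun k => t k / 2) S.

(* The laws of c + S_t over all its realizations on all probability spaces. *)
Definition shifted_calS_laws (R : realType) (c : R) (t : nat -> R) :
    set (borel_set R -> \bar R) :=
  [set m | exists (d : measure_display) (T : measurableType d)
             (P : probability T R) (S : {RV P >-> R}),
     is_calS t S /\ m = law P (fun w => c + S w)].

(* The distribution of c + S_t, by definite description. The junk value 0,
   taken when S_t has no realization or the law depends on the realization, is
   not a probability law, hence never in [generalized_uniform_sum_laws]. *)
Definition shifted_calS_law (R : realType) (c : R) (t : nat -> R) :
    borel_set R -> \bar R :=
  xget (fun=> 0%E) [set m | shifted_calS_laws c t = [set m]].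

Definition standardize (R : realType) (d : measure_display)
    (T : measurableType d) (P : probability T R) (X : T -> R) : T -> R :=
  fun w => (X w - fine 'E_P[X]) / Num.sqrt (fine 'V_P[X]).

(* Main.v *)
(** The law of S_t is determined by s |-> E cos (s S_t), which equals the
    product of the sinc (s t_k / 2), and S_t is centered.

    Injectivity.  The mean of c + S_t is c, and then the law determines the
    product.  If t and u first differ at n, with t_n > u_n, the common factors
    k < n do not vanish just to the right of s = 2 pi / t_n; there the product
    of t is almost zero because of its factor n, while the product of the
    factors k >= n of u stays away from 0 since their first zeros lie further
    to the right.

    Surjectivity.  A partial sum of independent U[a_k, b_k] is independent of
    the remainder of the series S, so that sum_k (b_k - a_k)^2 / 12 <= Var S.
    The centered summands then converge almost surely by Kolmogorov's
    inequality, hence so does the series of midpoints, and a greedy argument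
    rearranges the lengths decreasingly; in L^2 the rearranged series has the
    same sum.

    Existence.  The even and the odd binary digits of a uniform variable on
    [0, 1] are independent and uniform, because shifting the digits shows that
    the defect of this property at some pair of rays is at most half its defect
    at another pair; iterating the splitting yields an i.i.d. sequence. *)
Require Import Defs.
From HB Require Import structures.
From mathcomp Require Import all_boot all_order all_algebra finmap.
From mathcomp Require Import all_classical all_reals all_analysis.
From mathcomp Require Import ring lra measurable_realfun.

Set Implicit Arguments.
Unset Strict Implicit.
Unset Printing Implicit Defensive.

Import Order.TTheory GRing.Theory Num.Theory.
Import numFieldNormedType.Exports.

Local Open Scope classical_set_scope.
Local Open Scope ring_scope.

(** * Sequences and series *)

Lemma halving_eq0 (R : realType) (I : Type) (u : I -> R) :
  (forall i, 0 <= u i <= 1) -> (forall i, exists j, u i <= u j / 2) ->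
  forall i, u i = 0.
Proof.
move=> u01 uhalf i; have u_geometric n : forall j, u j <= 2^-1 ^+ n.
  elim: n => [|n IH] j; first by rewrite expr0; case/andP: (u01 j).
  have [k /le_trans] := uhalf j; apply.
  by rewrite exprSr ler_wpM2r ?invr_ge0.
apply/eqP; rewrite eq_le; case/andP: (u01 i) => -> _; rewrite andbT.
have half_lt1 : `|2^-1 : R| < 1.
  by rewrite ger0_norm ?invr_ge0// invf_lt1// ltr1n.
rewrite -(cvg_lim _ (cvg_expr half_lt1))//; apply: limr_ge.
  by apply/cvg_ex; exists 0; exact: cvg_expr.
by apply: nearW => n; exact: u_geometric.
Qed.

Lemma big_nat_shift (R : Type) (idx : R) (op : R -> R -> R) m n (F : nat -> R) :
  \big[op/idx]_(m <= k < m + n) F k = \big[op/idx]_(0 <= k < n) F (m + k)%N.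
Proof.
rewrite -[in LHS](add0n m) big_addn addKn.
by apply: eq_bigr => k _; rewrite addnC.
Qed.

Lemma sum_tail_le (R : realType) (a : nat -> R) N n :
  (forall k, 0 <= a k) -> cvgn (series a) ->
  \sum_(0 <= k < n) a (N + k)%N <= limn (series a) - series a N.
Proof.
move=> a0 ca; rewrite lerBrDl -big_nat_shift.
rewrite -(big_cat_nat (leq0n N) (leq_addr n N))/=.
by apply: nondecreasing_cvgn_le => //; exact: nondecreasing_series.
Qed.

Lemma prod_onem_ge (R : realDomainType) (a : nat -> R) n :
  (forall k, 0 <= a k <= 1) ->
  1 - \sum_(0 <= k < n) a k <= \prod_(0 <= k < n) (1 - a k).
Proof.
move=> a01; elim: n => [|n IH]; first by rewrite !big_geq// subr0.
rewrite !big_nat_recr//=; have /andP[an0 an1] := a01 n.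
have sum0 : 0 <= \sum_(0 <= k < n) a k.
  by apply: sumr_ge0 => k _; case/andP: (a01 k).
apply: (@le_trans _ _ ((1 - \sum_(0 <= k < n) a k) * (1 - a n))).
  by have := mulr_ge0 sum0 an0; nra.
by rewrite ler_wpM2r// subr_ge0.
Qed.

(* The bound is uniform in the factors: only a finite number of them can be
   smaller than 1 - a k >= 1 / 2. *)
Lemma prod_bounded_below (R : realType) (a : nat -> R) (b : R) :
  (forall k, 0 <= a k) -> cvgn (series a) -> 0 < b <= 1 ->
  exists2 c : R, 0 < c & forall (f : nat -> R) n,
    (forall k, b <= f k) -> (forall k, 1 - a k <= f k) ->
    c <= \prod_(0 <= k < n) f k.
Proof.
move=> a0 ca /andP[b0 b1].
have half0 : 0 < 2^-1 :> R by rewrite invr_gt0.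
have [N _ /(_ N (leqnn N)) tailN] :
    \forall N \near \oo, `|limn (series a) - series a N| < 2^-1.
  exact: (@cvgr_dist_lt _ _ _ _ _ _ _ ca).
have tail_le n : \sum_(0 <= k < n) a (N + k)%N <= 2^-1.
  apply: le_trans (sum_tail_le N n a0 ca) _.
  exact: le_trans (ler_norm _) (ltW tailN).
have a1 k : 0 <= a (N + k)%N <= 1.
  rewrite a0/=; have := tail_le k.+1; rewrite big_nat_recr//=.
  have : 0 <= \sum_(0 <= j < k) a (N + j)%N by exact: sumr_ge0.
  lra.
exists (b ^+ N * 2^-1); first by rewrite mulr_gt0 ?invr_gt0// exprn_gt0.
move=> f n bf af; pose g k := Num.min 1 (f k).
have g_ge x k : x <= 1 -> x <= f k -> x <= g k by rewrite le_min => -> ->.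
have g0 k : 0 <= g k by rewrite g_ge// (le_trans (ltW b0)).
have prod_g0 m p : 0 <= \prod_(m <= k < p) g k by exact: prodr_ge0.
apply: (@le_trans _ _ (\prod_(0 <= k < N + n) g k)); last first.
  apply: (@le_trans _ _ (\prod_(0 <= k < n) g k)); last first.
    by apply: ler_prod => k _; rewrite g0 ge_min lexx orbT.
  rewrite (big_cat_nat (leq0n n) (leq_addl N n))/= ler_piMr//.
  by apply: prodr_ile1 => k _; rewrite g0 ge_min lexx.
rewrite (big_cat_nat (leq0n N) (leq_addr n N))/=.
rewrite ler_pM ?exprn_ge0 ?invr_ge0 ?(ltW b0)//.
  rewrite -[X in b ^+ X](subn0 N) -prodr_const_nat; apply: ler_prod => k _.
  by rewrite (ltW b0) g_ge.
rewrite big_nat_shift.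
apply: (@le_trans _ _ (\prod_(0 <= k < n) (1 - a (N + k)%N))).
  by apply: le_trans (prod_onem_ge _ a1); have := tail_le n; lra.
apply: ler_prod => k _; have /andP[_ ak1] := a1 k.
by rewrite subr_ge0 ak1 g_ge// gerBl.
Qed.

Section rearrangement.
Context (R : realType).
Implicit Types (l v : nat -> R) (r : nat -> nat).

Lemma argmax_outside l (s : seq nat) :
  (forall k, 0 <= l k) -> l @ \oo --> (0 : R) ->
  exists k : nat, k \notin s /\ forall j : nat, j \notin s -> l j <= l k.
Proof.
move=> l0 cl.
have [[j js lj]|l_out0] := pselect (exists2 j, j \notin s & 0 < l j).
  have [N _ lN] : \forall n \near \oo, `|0 - l n| < l j.
    exact: (@cvgr_dist_lt _ _ _ _ _ _ _ cl).
  pose M := maxn N j.+1; have jM : (j < M)%N by rewrite leq_maxr.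
  have js' : Ordinal jM \in [pred i : 'I_M | (i : nat) \notin s] by rewrite inE.
  have [i iS imax] := @arg_maxP _ _ _ (Ordinal jM)
    [pred i : 'I_M | (i : nat) \notin s] (fun i : 'I_M => l i) js'.
  exists (nat_of_ord i); split; first exact: iS.
  move=> k ks; have [kM|Mk] := ltnP k M; first exact: (imax (Ordinal kM)).
  apply: (@le_trans _ _ (l j)); last exact: (imax (Ordinal jM)).
  have := lN k; rewrite /= (leq_trans (leq_maxl N j.+1) Mk) => /(_ isT).
  by rewrite sub0r normrN ger0_norm// => /ltW.
exists (\max_(i <- s) i).+1; split.
  apply/negP => ks.
  by have := @leq_bigmax_seq _ s xpredT id _ ks isT; rewrite ltnn.
move=> j js; apply: le_trans (l0 _); rewrite leNgt; apply/negP => lj.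
by apply: l_out0; exists j.
Qed.

Fixpoint greedy_history (g : seq nat -> nat) (n : nat) : seq nat :=
  if n is m.+1 then g (greedy_history g m) :: greedy_history g m else [::].

Lemma greedy_inj (g : seq nat -> nat) : (forall s, g s \notin s) ->
  injective (fun n => g (greedy_history g n)).
Proof.
move=> gnotin.
have mem_history m n :
    (m < n)%N -> g (greedy_history g m) \in greedy_history g n.
  elim: n => // n IH; rewrite ltnS leq_eqVlt => /predU1P[->|mn].
    by rewrite /= mem_head.
  by rewrite /= inE IH ?orbT.
move=> m n mn; case: (ltngtP m n) => // lt.
  by have := gnotin (greedy_history g n); rewrite -mn mem_history.
by have := gnotin (greedy_history g m); rewrite mn mem_history.
Qed.

Lemma inj_large r N : injective r -> exists n, (N <= r n)%N.
Proof.
move=> rI; apply: contrapT => /forallNP small.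
have rN n : (r n < N)%N by rewrite ltnNge; exact/negP.
have rsub : {subset map r (iota 0 N.+1) <= iota 0 N}.
  by move=> _ /mapP[i _ ->]; rewrite mem_iota add0n/= rN.
have runiq : uniq (map r (iota 0 N.+1)) by rewrite map_inj_uniq// iota_uniq.
by have := uniq_leq_size runiq rsub; rewrite size_map !size_iota ltnn.
Qed.

Lemma decreasing_rearrangement l :
  (forall k, 0 <= l k) -> l @ \oo --> (0 : R) ->
  exists r, [/\ injective r, forall n, l (r n.+1) <= l (r n) &
    forall k, 0 < l k -> exists n, r n = k].
Proof.
move=> l0 cl.
pose g s := sval (cid (argmax_outside s l0 cl)).
have gP s : g s \notin s /\ forall j, j \notin s -> l j <= l (g s).
  by rewrite /g; case: cid.
pose r n := g (greedy_history g n).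
have rI : injective r by apply: greedy_inj => s; case: (gP s).
exists r; split => // [n|k lk].
  have [_ rmax] := gP (greedy_history g n); apply: rmax.
  by have [] := gP (greedy_history g n.+1); rewrite inE negb_or => /andP[].
apply: contrapT => /forallNP nk.
have k_notin n : k \notin greedy_history g n.
  elim: n => // n IH.
  by rewrite inE negb_or IH andbT; apply/eqP => /esym/(nk n).
have [N _ lN] : \forall n \near \oo, `|0 - l n| < l k.
  exact: (@cvgr_dist_lt _ _ _ _ _ _ _ cl).
have [n /lN] := inj_large N rI; rewrite sub0r normrN ger0_norm// ltNge => /negP.
by apply; have [_ rmax] := gP (greedy_history g n); exact: rmax (k_notin n).
Qed.

Lemma cvg_series_nneseries v : (forall k, 0 <= v k) ->
  ((series v n)%:E @[n --> \oo] --> \sum_(k <oo) (v k)%:E)%E.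
Proof.
move=> v0; under eq_fun do rewrite /series/= -sumEFin.
by apply: is_cvg_nneseries => k _ _; rewrite lee_fin.
Qed.

Lemma cvg_series_rearrangement v r : (forall k, 0 <= v k) -> cvgn (series v) ->
  injective r -> (forall k, 0 < v k -> exists n, r n = k) ->
  series (v \o r) @ \oo --> limn (series v).
Proof.
move=> v0 cv rI hit.
have vr0 k : 0 <= (v \o r) k by exact: v0.
have sum_v : (\sum_(k <oo) (v k)%:E = (limn (series v))%:E)%E.
  apply: cvg_unique (cvg_series_nneseries v0) _ => //.
  by apply: cvg_EFin; [exact: nearW|].
have := cvg_series_nneseries vr0.
rewrite (_ : (\sum_(k <oo) _ = \sum_(k <oo) (v k)%:E)%E).
  by rewrite sum_v => /fine_cvgP[].
rewrite !nneseries_esumT; [|by move=> k; rewrite lee_fin..].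
rewrite -(@esum_image _ _ _ setT r (fun k => (v k)%:E) (in2W rI)) esum_mkcond.
apply: eq_esum => k _; case: ifPn => // /negP k_out; congr EFin.
apply/esym/eqP; rewrite eq_le v0 andbT leNgt; apply/negP => /hit[n rnk].
by apply: k_out; rewrite inE; exists n.
Qed.

Lemma rearrangement_bound r n : exists N, forall k, (k < n)%N -> (r k < N)%N.
Proof.
exists (\max_(k < n) r k).+1 => k kn; rewrite ltnS.
exact: (@leq_bigmax _ (fun k : 'I_n => r k) (Ordinal kn)).
Qed.

Definition unused_indices r n k : bool := k \notin [seq r i | i <- iota 0 n].

Lemma sum_unused_indices r (f : nat -> R) n N : injective r ->
  (forall k, (k < n)%N -> (r k < N)%N) ->
  \sum_(0 <= k < N) (unused_indices r n k)%:R * f k =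
  \sum_(0 <= k < N) f k - \sum_(0 <= k < n) f (r k).
Proof.
move=> rI rN; rewrite [X in _ - X](_ : _ =
  \sum_(0 <= k < N | ~~ unused_indices r n k) f k).
  rewrite [X in X - _](bigID (unused_indices r n))/= addrK [RHS]big_mkcond/=.
  by apply: eq_bigr => k _; case: unused_indices; rewrite ?mul1r ?mul0r.
transitivity (\sum_(j <- [seq r i | i <- iota 0 n]) f j).
  by rewrite big_map /index_iota subn0.
rewrite -[RHS]big_filter; apply: perm_big; apply: uniq_perm => [||j].
- by rewrite map_inj_uniq// iota_uniq.
- by rewrite filter_uniq// iota_uniq.
- rewrite mem_filter mem_index_iota/= negbK.
  case: (boolP (j \in _)) => //= /mapP[k]; rewrite mem_iota/= add0n => kn ->.
  by rewrite rN.
Qed.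

End rearrangement.

(** * Laws on the real line *)

Lemma measurable_preimage (d d' : measure_display) (T : measurableType d)
    (T' : measurableType d') (f : T -> T') (A : set T') :
  measurable_fun setT f -> measurable A -> measurable (f @^-1` A).
Proof. by move=> mf mA; rewrite -[X in measurable X]setTI; exact: mf. Qed.

Lemma continuous_affine (R : realType) (c e : R) :
  continuous (fun x : R => c * x + e).
Proof.
move=> x; apply: cvgD; last exact: cvg_cst.
by apply: cvgM; [exact: cvg_cst|exact: cvg_id].
Qed.

Lemma measurable_affine (R : realType) (c e : R) :
  measurable_fun setT (fun x : R => c * x + e).
Proof.
by apply: continuous_measurable_fun; exact: continuous_affine.
Qed.

Lemma normr_indic_le1 (T : Type) (R : numDomainType) (A : set T) (w : T) :
  `|\1_A w : R| <= 1.
Proof. by rewrite indicE ger0_norm// lern1 leq_b1. Qed.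

Lemma measure_unique_rays (R : realType) (m1 m2 : {measure set R -> \bar R}) :
  (m1 setT < +oo)%E ->
  (forall x : R, m1 `]x, +oo[%classic = m2 `]x, +oo[%classic) ->
  forall A, measurable A -> m1 A = m2 A.
Proof.
move=> m1oo m12.
apply: (measure_unique (@RGenOInfty.G R)
  (fun k => `]- k%:R, +oo[%classic)) => //.
- exact: RGenOInfty.measurableE.
- move=> _ _ [x ->] [y ->]; exists (Num.max x y).
  apply/seteqP; split=> z /=; rewrite !in_itv/= !andbT gt_max.
    by move=> [-> ->].
  by move=> /andP.
- by move=> k; exists (- k%:R).
- apply/seteqP; split=> // z _.
  exists (Num.bound `|z|) => //=; rewrite in_itv/= andbT ltrNl.
  by rewrite (le_lt_trans (ler_norm _))// normrN archi_boundP.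
- by move=> _ [x ->]; exact: m12.
- by move=> k; apply: le_lt_trans m1oo; apply: le_measure; rewrite ?inE.
Qed.

Section ramp.
Context (R : realType).
Implicit Types (x y : R) (m n : nat).

Definition ramp x n y : R := Num.min 1 (Num.max 0 (n%:R * (y - x))).

Lemma continuous_ramp x n : continuous (ramp x n).
Proof.
move=> y; apply: (@continuous_min R _ (cst 1)
  (fun z => Num.max 0 (n%:R * (z - x)))); first exact: cvg_cst.
apply: (@continuous_max R _ (cst 0) (fun z => n%:R * (z - x))).
  exact: cvg_cst.
apply: cvgM; first exact: cvg_cst.
by apply: cvgB; [exact: cvg_id|exact: cvg_cst].
Qed.

Lemma ramp01 x n y : 0 <= ramp x n y <= 1.
Proof. by rewrite le_min ler01 le_max lexx/= ge_min lexx. Qed.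

Lemma ramp_nondecreasing x m n y : (m <= n)%N -> ramp x m y <= ramp x n y.
Proof.
move=> mn; rewrite /ramp le_min2//; have [yx|yx] := lerP (y - x) 0.
  by rewrite (max_idPl _) ?le_max ?lexx// mulr_ge0_le0.
by rewrite le_max2// ler_wpM2r ?ler_nat// ltW.
Qed.

Lemma ramp_cvg x y :
  ramp x n y @[n --> \oo] --> (\1_(`]x, +oo[%classic) y : R).
Proof.
apply: cvg_near_cst; rewrite indicE.
case: (boolP (y \in _)); rewrite /= ?notin_setE ?inE/= in_itv/= andbT.
  move=> xy; near=> n; rewrite /ramp.
  have ? : 1 <= n%:R * (y - x).
    rewrite -ler_pdivrMr ?subr_gt0//.
    near: n; exact: nbhs_infty_ger.
  by rewrite (max_idPr _) ?(min_idPl _)// (le_trans ler01).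
move=> /negP; rewrite -leNgt => yx.
apply: nearW => n; rewrite /ramp (max_idPl _) ?(min_idPr _)//.
by rewrite mulr_ge0_le0// subr_le0.
Unshelve. all: by end_near. Qed.

Lemma integral_ramp_cvg (m : {measure set R -> \bar R}) x :
  (\int[m]_y (ramp x n y)%:E)%E @[n --> \oo] --> m `]x, +oo[%classic.
Proof.
rewrite -[X in m X]setIT -integral_indic//.
rewrite (eq_integral (fun y => limn (fun n => (ramp x n y)%:E))).
  apply: cvg_monotone_convergence => //.
  - move=> n; apply/measurable_EFinP; apply: continuous_measurable_fun.
    exact: continuous_ramp.
  - by move=> n y _; rewrite lee_fin; case/andP: (ramp01 x n y).
  - by move=> y _ a b ab; rewrite lee_fin ramp_nondecreasing.
move=> y _; apply/esym/cvg_lim => //.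
by apply: cvg_EFin; [exact: nearW|exact: ramp_cvg].
Qed.

End ramp.

Lemma measure_unique_continuous (R : realType)
    (m1 m2 : {measure set R -> \bar R}) :
  (m1 setT < +oo)%E ->
  (forall f : R -> R, continuous f -> (forall x, 0 <= f x <= 1) ->
    (\int[m1]_x (f x)%:E = \int[m2]_x (f x)%:E)%E) ->
  forall A, measurable A -> m1 A = m2 A.
Proof.
move=> m1oo m12; apply: measure_unique_rays => // x.
have := integral_ramp_cvg (m := m1) (x := x).
rewrite (eq_cvg _ _ (fun n => m12 _ (@continuous_ramp R x n) (ramp01 x n))).
by move=> /cvg_unique; apply => //; exact: integral_ramp_cvg.
Qed.

Lemma measure_ae_eq (d : measure_display) (T : measurableType d)
    (R : realType) (mu : {measure set T -> \bar R}) (A B : set T) :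
  measurable A -> measurable B -> {ae mu, forall w, A w <-> B w} ->
  mu A = mu B.
Proof.
move=> mA mB AB; rewrite -(setIT A) -(setIT B) -!integral_indic//.
apply: ae_eq_integral => //; try exact/measurable_EFinP/measurable_indic.
apply: filterS AB => w AB _; rewrite !indicE; congr (_%:R%:E).
by congr nat_of_bool; apply/idP/idP; rewrite !inE AB.
Qed.

Lemma ae_nonempty (d : measure_display) (T : measurableType d) (R : realType)
    (P : probability T R) (Q : T -> Prop) :
  {ae P, forall w, Q w} -> exists w, Q w.
Proof.
move=> [N [mN PN QN]]; apply: contrapT => /forallNP nQ.
have NT : N = setT by apply/seteqP; split => // w _; apply: QN; exact: nQ.
have := @probability_setT _ _ _ P; rewrite -NT PN => /eqP.
by rewrite eq_sym onee_eq0.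
Qed.

Lemma variance_integral (R : realType) (d : measure_display)
    (T : measurableType d) (P : probability T R) (X : T -> R) :
  ('V_P[X] = \int[P]_w ((X w - fine 'E_P[X]) ^+ 2)%:E)%E.
Proof.
rewrite /variance unlock; set m := fine _; rewrite unlock.
by apply: eq_integral => w _; rewrite expr2.
Qed.

Section law.
Context (R : realType) (d d' : measure_display).
Context (T : measurableType d) (P : probability T R).
Context (T' : measurableType d') (Q : probability T' R).

Lemma law_eqP (X : T -> R) (Y : T' -> R) :
  law P X = law Q Y <->
  forall A, measurable A -> P (X @^-1` A) = Q (Y @^-1` A).
Proof.
split=> [XY A mA|XY]; first by have := congr1 (@^~ (exist _ A mA)) XY.
by apply/funext => -[A mA]; exact: XY.
Qed.

Lemma law_comp (X : T -> R) (Y : T' -> R) (g : R -> R) :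
  measurable_fun setT g -> law P X = law Q Y ->
  law P (g \o X) = law Q (g \o Y).
Proof.
move=> mg /law_eqP XY; apply/law_eqP => A mA.
by apply: (XY (g @^-1` A)); exact: measurable_preimage.
Qed.

Lemma integral_law (X : {RV P >-> R}) (Y : {RV Q >-> R}) (f : R -> \bar R) :
  measurable_fun setT f -> law P X = law Q Y ->
  (\int[P]_w f (X w) = \int[Q]_w f (Y w))%E.
Proof.
move=> mf /law_eqP XY.
have ge0_eq (g : R -> \bar R) : measurable_fun setT g ->
    (forall x, 0 <= g x)%E -> (\int[P]_w g (X w) = \int[Q]_w g (Y w))%E.
  move=> mg g0.
  have := ge0_integral_distribution X mg g0.
  have := ge0_integral_distribution Y mg g0.
  rewrite /= => <- <-; apply: eq_measure_integral => A mA _; exact: XY.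
have integral_posneg (d1 : measure_display) (T1 : measurableType d1)
    (P1 : probability T1 R) (Z : T1 -> R) :
    (\int[P1]_w f (Z w) =
     \int[P1]_w f^\+ (Z w) - \int[P1]_w f^\- (Z w))%E.
  by rewrite (integralE _ _ (f \o Z)) funepos_comp funeneg_comp.
rewrite !integral_posneg !ge0_eq//.
  exact: measurable_funeneg.
exact: measurable_funepos.
Qed.

Lemma expectation_law (X : {RV P >-> R}) (Y : {RV Q >-> R}) :
  law P X = law Q Y -> 'E_P[X]%E = 'E_Q[Y]%E.
Proof. by move=> XY; rewrite unlock; exact: (integral_law (f := EFin)). Qed.

Lemma variance_law (X : {RV P >-> R}) (Y : {RV Q >-> R}) :
  law P X = law Q Y -> 'V_P[X]%E = 'V_Q[Y]%E.
Proof.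
move=> XY; rewrite !variance_integral (expectation_law XY).
apply: (integral_law (f := fun x => ((x - fine 'E_Q[Y]%E) ^+ 2)%:E)) => //.
by apply/measurable_EFinP; apply: measurable_funX; exact: measurable_funB.
Qed.

End law.

(** * Expectation *)

Section expectation_complements.
Context (R : realType) (d : measure_display) (T : measurableType d).
Context (P : probability T R).
Implicit Types X Y : T -> R.

Lemma Lfun_measurable p X : X \in Lfun P p -> measurable_fun setT X.
Proof. by rewrite inE => /andP[/set_mem]. Qed.

Lemma bounded_Lfun1 X (M : R) :
  measurable_fun setT X -> (forall w, `|X w| <= M) -> X \in Lfun P 1.
Proof.
move=> mX XM; apply/Lfun1_integrable.
apply: measurable_bounded_integrable => //.
  by rewrite (le_lt_trans (probability_le1 P measurableT))// ltry.
exists M; split; first by rewrite num_real.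
by move=> y /ltW My w _ /=; exact: le_trans (XM w) My.
Qed.

Lemma expectation_dominated_cvg (X_ : nat -> T -> R) X Y :
  (forall n, measurable_fun setT (X_ n)) -> measurable_fun setT X ->
  Y \in Lfun P 1 -> (forall n w, `|X_ n w| <= Y w) ->
  {ae P, forall w, X_ n w @[n --> \oo] --> X w} ->
  ('E_P[X_ n] @[n --> \oo] --> 'E_P[X])%E.
Proof.
move=> mX_ mX /Lfun1_integrable iY XY cX; rewrite unlock.
have [//||||||_ _ cE] := @dominated_convergence _ _ _ P setT _
  (fun n => EFin \o X_ n) (EFin \o X) (EFin \o Y).
- by move=> n; exact/measurable_EFinP.
- exact/measurable_EFinP.
- by apply: filterS cX => w cw _; apply: cvg_EFin; [exact: nearW|].
- exact: iY.
- by apply: aeW => w n _; rewrite lee_fin.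
- exact: cE.
Qed.

Lemma expectation_bounded_cvg (X_ : nat -> T -> R) X (M : R) :
  (forall n, measurable_fun setT (X_ n)) -> measurable_fun setT X ->
  (forall n w, `|X_ n w| <= M) ->
  {ae P, forall w, X_ n w @[n --> \oo] --> X w} ->
  ('E_P[X_ n] @[n --> \oo] --> 'E_P[X])%E.
Proof.
move=> mX_ mX XM; apply: (expectation_dominated_cvg (Y := cst M)) => //.
exact: Lfun_cst.
Qed.

Lemma Lfun2_Lfun1 X : X \in Lfun P 2%:E -> X \in Lfun P 1.
Proof. by apply: Lfun_subset12; exact: fin_num_measure. Qed.

Lemma Lfun2P X : measurable_fun setT X ->
  (\int[P]_w (X w ^+ 2)%:E < +oo)%E -> X \in Lfun P 2%:E.
Proof.
move=> mX X2; rewrite inE; apply/andP; split; rewrite inE//=.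
rewrite /finite_norm unlock; apply: poweR_lty.
apply: le_lt_trans X2; rewrite le_eqVlt; apply/orP; left; apply/eqP.
by apply: eq_integral => w _; rewrite /= powR_mulrn// real_normK ?num_real.
Qed.

Lemma Lfun2M_bounded X Y (M : R) : X \in Lfun P 2%:E -> measurable_fun setT Y ->
  (forall w, `|Y w| <= M) -> (fun w => Y w * X w) \in Lfun P 2%:E.
Proof.
move=> X2 mY YM; have mX := Lfun_measurable X2.
have /integrableP[_] :=
  integrableZl measurableT (M ^+ 2) (Lfun2_integrable_sqr X2).
move=> iX; apply: Lfun2P; first exact: measurable_funM.
apply: le_lt_trans iX; apply: ge0_le_integral => //.
- by move=> w _; rewrite lee_fin sqr_ge0.
- by apply/measurable_EFinP; apply: measurable_funX; exact: measurable_funM.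
- apply: measurableT_comp => //; apply: measurable_funeM.
  by apply/measurable_EFinP; exact: measurable_funX.
- move=> w _ /=; rewrite lee_fin (le_trans _ (ler_norm _))// exprMn.
  rewrite ler_wpM2r ?sqr_ge0//.
  rewrite -[leLHS]real_normK ?num_real//.
  by rewrite lerXn2r ?nnegrE// (le_trans _ (YM w)).
Qed.

Lemma finite_variance_Lfun2 X : X \in Lfun P 1 -> ('V_P[X] < +oo)%E ->
  X \in Lfun P 2%:E.
Proof.
move=> X1 VX; have mX := Lfun_measurable X1; set m := fine 'E_P[X]%E.
have -> : X = (fun w => X w - m) + cst m.
  by apply/funext => w /=; rewrite fctE subrK.
rewrite rpredD ?lee1n// => one_le2; last exact: Lfun_cst.
by apply: Lfun2P; rewrite -?variance_integral//; exact: measurable_funB.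
Qed.

Lemma variance_centered X : X \in Lfun P 2%:E -> 'E_P[X]%E = 0%E ->
  ('V_P[X] = \int[P]_w (X w ^+ 2)%:E)%E.
Proof.
by move=> X2 EX; rewrite varianceE// EX expe2 mule0 sube0 unlock.
Qed.

Lemma sqr_expectation_le X : X \in Lfun P 2%:E ->
  ('E_P[X] ^+ 2 <= \int[P]_w (X w ^+ 2)%:E)%E.
Proof.
move=> X2; have := variance_ge0 P X; rewrite varianceE// sube_ge0.
  by rewrite unlock.
by rewrite fin_numX// expectation_fin_num ?Lfun2_Lfun1.
Qed.

Lemma fatou_second_moment (X_ : nat -> T -> R) X b :
  (forall n, measurable_fun setT (X_ n)) -> measurable_fun setT X ->
  {ae P, forall w, X_ n w @[n --> \oo] --> X w} ->
  (\forall n \near \oo, (\int[P]_w (X_ n w ^+ 2)%:E <= b)%E) ->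
  (\int[P]_w (X w ^+ 2)%:E <= b)%E.
Proof.
move=> mX_ mX cX [N _ Xb].
pose sqr_ n w := (X_ (n + N)%N w ^+ 2)%:E.
have msqr n : measurable_fun setT (sqr_ n).
  by apply/measurable_EFinP; exact: measurable_funX.
have sqr_ge0 n w : setT w -> (0 <= sqr_ n w)%E by rewrite lee_fin sqr_ge0.
rewrite (ae_eq_integral (fun w => limn_einf (sqr_ ^~ w)))//.
- apply: le_trans (fatou P measurableT msqr sqr_ge0) _.
  rewrite limn_einf_lim; apply: lime_le; first exact: is_cvg_einfs.
  apply: nearW => n; apply: le_trans (Xb (n + N)%N (leq_addl _ _)).
  by apply: ereal_inf_lbound; exists n => //=.
- by apply/measurable_EFinP; exact: measurable_funX.
- under eq_fun do rewrite limn_einf_lim.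
  apply: (emeasurable_fun_cvg (fun n w => einfs (sqr_ ^~ w) n)).
    exact: measurable_fun_einfs.
  by move=> w _; exact: is_cvg_einfs.
- apply: filterS cX => w Xw _; apply/esym.
  apply: (cvg_limn_einf_sup _).1; apply: cvg_EFin; first exact: nearW.
  have sqr_cvg : X_ n w ^+ 2 @[n --> \oo] --> X w ^+ 2.
    by under eq_fun do rewrite expr2; rewrite expr2; exact: cvgM.
  by rewrite -(cvg_shiftn N) in sqr_cvg.
Qed.

Lemma ae_eq0_second_moment X : measurable_fun setT X ->
  (\int[P]_w (X w ^+ 2)%:E <= 0)%E -> {ae P, forall w, X w = 0}.
Proof.
move=> mX X0.
have mX2 : measurable_fun setT (fun w => (X w ^+ 2)%:E).
  by apply/measurable_EFinP; exact: measurable_funX.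
have /(ae_eq_integral_abs _ measurableT mX2) :
    (\int[P]_w `|(X w ^+ 2)%:E| = 0)%E.
  apply/eqP; rewrite eq_le integral_ge0// andbT; apply: le_trans X0.
  rewrite le_eqVlt; apply/orP; left; apply/eqP; apply: eq_integral => w _.
  by rewrite gee0_abs// lee_fin sqr_ge0.
by apply: filterS => w /(_ I)/= [] /eqP; rewrite sqrf_eq0 => /eqP.
Qed.

End expectation_complements.

Section affine_RV.
Context (R : realType) (d : measure_display) (T : measurableType d).
Context (P : probability T R).
Implicit Types (c e : R) (X : {RV P >-> R}).

Let measurable_affine_RV c e X : measurable_fun setT (fun w => c * X w + e).
Proof. exact: (measurableT_comp (measurable_affine c e)). Qed.

Definition affine_RV c e X : {RV P >-> R} :=
  mfun_Sub (mem_set (measurable_affine_RV c e X)).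

Lemma affine_RVE c e X w : affine_RV c e X w = c * X w + e.
Proof. by []. Qed.

Let affineE c e X : (affine_RV c e X : T -> R) = (c \o* X) \+ cst e.
Proof. by apply/funext => w; rewrite affine_RVE mulrC. Qed.

Lemma Lfun2_affine c e X : (X : T -> R) \in Lfun P 2%:E ->
  (affine_RV c e X : T -> R) \in Lfun P 2%:E.
Proof.
move=> X2; rewrite affineE rpredD ?lee1n// => one_le2; last exact: Lfun_cst.
by rewrite Lfun_scale// ler1n.
Qed.

Lemma expectation_affine c e X : (X : T -> R) \in Lfun P 1 ->
  ('E_P[affine_RV c e X] = c%:E * 'E_P[X] + e%:E)%E.
Proof.
move=> X1; rewrite affineE expectationD ?Lfun_scale ?Lfun_cst//.
by rewrite expectationZl// expectation_cst.
Qed.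

Lemma variance_affine c e X : (X : T -> R) \in Lfun P 2%:E ->
  ('V_P[affine_RV c e X] = (c ^+ 2)%:E * 'V_P[X])%E.
Proof.
by move=> X2; rewrite affineE varianceD_cst_r ?varianceZ// Lfun_scale// ler1n.
Qed.

End affine_RV.

Lemma law_ae_eq (R : realType) (d : measure_display) (T : measurableType d)
    (P : probability T R) (X Y : T -> R) :
  measurable_fun setT X -> measurable_fun setT Y ->
  {ae P, forall w, X w = Y w} -> law P X = law P Y.
Proof.
move=> mX mY XY; apply/law_eqP => A mA.
apply: measure_ae_eq; [exact: measurable_preimage..|].
by apply: filterS XY => w /= ->.
Qed.

Lemma law_eq_cvg (R : realType) (d d' : measure_display)
    (T : measurableType d) (P : probability T R)
    (T' : measurableType d') (Q : probability T' R)
    (X_ : nat -> {RV P >-> R}) (Y_ : nat -> {RV Q >-> R})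
    (X : {RV P >-> R}) (Y : {RV Q >-> R}) :
  {ae P, forall w, X_ n w @[n --> \oo] --> X w} ->
  {ae Q, forall w, Y_ n w @[n --> \oo] --> Y w} ->
  (forall n, law P (X_ n) = law Q (Y_ n)) -> law P X = law Q Y.
Proof.
move=> cX cY XY; apply/law_eqP.
apply: (@measure_unique_continuous R (distribution P X) (distribution Q Y)).
  by rewrite (le_lt_trans (probability_le1 _ _))// ltry.
move=> f cf f01.
have mf : measurable_fun setT f by exact: continuous_measurable_fun.
have f1 x : `|f x| <= 1 by case/andP: (f01 x) => f0 f1; rewrite ger0_norm.
have cvgE (d1 : measure_display) (T1 : measurableType d1)
    (P1 : probability T1 R) (Z_ : nat -> {RV P1 >-> R}) (Z : {RV P1 >-> R}) :
    {ae P1, forall w, Z_ n w @[n --> \oo] --> Z w} ->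
    ('E_P1[f \o Z_ n] @[n --> \oo] --> 'E_P1[f \o Z])%E.
  move=> cZ; apply: (expectation_bounded_cvg (M := 1)) => //.
  - by move=> n; exact: measurableT_comp.
  - exact: measurableT_comp.
  - by move=> n w; exact: f1.
  - by apply: filterS cZ => w; apply: continuous_cvg; exact: cf.
have f0 x : (0 <= (f x)%:E)%E by rewrite lee_fin; case/andP: (f01 x).
have mf' : measurable_fun setT (EFin \o f) by exact/measurable_EFinP.
rewrite !ge0_integral_distribution//.
have := cvgE _ _ _ _ _ cX; rewrite unlock => cEX.
have := cvgE _ _ _ _ _ cY; rewrite unlock => cEY.
apply: cvg_unique cEX _ => //; apply: cvg_trans cEY; apply: near_eq_cvg.
by apply: nearW => n; apply/esym; exact: (integral_law mf' (XY n)).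
Qed.

(** * Independence *)

Lemma integral_productM (d1 d2 : measure_display) (T1 : measurableType d1)
    (T2 : measurableType d2) (R : realType)
    (m1 : {sigma_finite_measure set T1 -> \bar R})
    (m2 : {sigma_finite_measure set T2 -> \bar R})
    (f : T1 -> R) (g : T2 -> R) :
  m1.-integrable setT (EFin \o f) -> m2.-integrable setT (EFin \o g) ->
  (m1 \x m2)%E.-integrable setT (fun z => (f z.1 * g z.2)%:E) /\
  (\int[(m1 \x m2)%E]_z (f z.1 * g z.2)%:E =
   \int[m1]_x (f x)%:E * \int[m2]_y (g y)%:E)%E.
Proof.
move=> f1 g1; have [/integrableP[_ foo] /integrableP[_ goo]] := (f1, g1).
have mf : measurable_fun setT f by apply/measurable_EFinP; case/integrableP: f1.
have mg : measurable_fun setT g by apply/measurable_EFinP; case/integrableP: g1.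
have mfg : measurable_fun setT (fun z => (f z.1 * g z.2)%:E).
  by apply/measurable_EFinP; apply: measurable_funM; exact: measurableT_comp.
have mfn : measurable_fun setT (fun x => `|f x|%:E).
  by apply/measurable_EFinP; exact: measurableT_comp.
have mgn : measurable_fun setT (fun y => `|g y|%:E).
  by apply/measurable_EFinP; exact: measurableT_comp.
have ifg : (m1 \x m2)%E.-integrable setT (fun z => (f z.1 * g z.2)%:E).
  apply/integrable12ltyP => //.
  under eq_integral => x _.
    under eq_integral do rewrite [(_ * _)%:E]EFinM abseM /=.
    rewrite ge0_integralZl//; over.
  rewrite ge0_integralZr//; last exact: integral_ge0.
  by rewrite lte_mul_pinfty ?integral_ge0 ?ge0_fin_numE ?integral_ge0.
split=> //; rewrite -integral12_prod_meas1//= /fubini_F/=.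
have [c cE] : exists c, (\int[m2]_y (g y)%:E = c%:E)%E.
  by exists (fine (\int[m2]_y (g y)%:E)); rewrite fineK ?integrable_fin_num.
under eq_integral => x _.
  under eq_integral do rewrite EFinM.
  rewrite integralZl// cE; over.
by rewrite cE integralZr.
Qed.

Section independent_pair.
Context (R : realType) (d : measure_display) (T : measurableType d).
Context (P : probability T R).

Definition independent_RV (d1 d2 : measure_display) (T1 : measurableType d1)
    (T2 : measurableType d2) (X : T -> T1) (Y : T -> T2) : Prop :=
  forall A B, measurable A -> measurable B ->
    P (X @^-1` A `&` Y @^-1` B) = (P (X @^-1` A) * P (Y @^-1` B))%E.

Lemma independent_RV_sym (d1 d2 : measure_display) (T1 : measurableType d1)
    (T2 : measurableType d2) (X : T -> T1) (Y : T -> T2) :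
  independent_RV X Y -> independent_RV Y X.
Proof. by move=> XY A B mA mB; rewrite setIC muleC XY. Qed.

Lemma independent_RV_comp (d1 d2 d1' d2' : measure_display)
    (T1 : measurableType d1) (T2 : measurableType d2)
    (T1' : measurableType d1') (T2' : measurableType d2')
    (X : T -> T1) (Y : T -> T2) (f : T1 -> T1') (g : T2 -> T2') :
  measurable_fun setT f -> measurable_fun setT g ->
  independent_RV X Y -> independent_RV (f \o X) (g \o Y).
Proof.
move=> mf mg XY A B mA mB.
by apply: (XY (f @^-1` A) (g @^-1` B)); exact: measurable_preimage.
Qed.

Lemma independent_event_rays (X : {RV P >-> R}) (D : set T) : measurable D ->
  (forall x : R, P (X @^-1` `]x, +oo[%classic `&` D) =
    (P (X @^-1` `]x, +oo[%classic) * P D)%E) ->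
  forall A, measurable A -> P (X @^-1` A `&` D) = (P (X @^-1` A) * P D)%E.
Proof.
move=> mD XD A mA.
have [p p0 PD] : exists2 p, 0 <= p & P D = p%:E.
  by exists (fine (P D)); rewrite ?fine_ge0 ?fineK ?fin_num_measure.
rewrite PD muleC.
apply: (@measure_unique_rays R (pushforward (mrestr P mD) X)
  (mscale (NngNum p0) (distribution P X)) _ _ A mA) => [|x].
  apply: le_lt_trans (probability_le1 P _) (ltry _).
  by apply: measurableI => //; exact: measurable_preimage.
by rewrite [LHS]XD PD muleC.
Qed.

Lemma independent_RV_rays (X Y : {RV P >-> R}) :
  (forall x y : R,
    P (X @^-1` `]x, +oo[%classic `&` Y @^-1` `]y, +oo[%classic) =
    (P (X @^-1` `]x, +oo[%classic) * P (Y @^-1` `]y, +oo[%classic))%E) ->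
  independent_RV X Y.
Proof.
move=> XY A B mA mB; rewrite setIC muleC.
apply: independent_event_rays => // [|y]; first exact: measurable_preimage.
rewrite setIC muleC; apply: independent_event_rays => //.
exact: measurable_preimage.
Qed.

Let measurable_pair_RV (X Y : {RV P >-> R}) :
  measurable_fun setT (fun w => (X w, Y w)).
Proof. exact: measurable_fun_pair. Qed.

Definition pair_RV (X Y : {RV P >-> R}) : {RV P >-> (R * R)%type} :=
  mfun_Sub (mem_set (measurable_pair_RV X Y)).

Lemma independent_pair_distribution (X Y : {RV P >-> R}) :
  independent_RV X Y -> forall A : set (R * R), measurable A ->
  P (pair_RV X Y @^-1` A) = (distribution P X \x distribution P Y)%E A.
Proof.
move=> XY A mA; apply/esym.
exact: (@product_measure_unique _ _ _ _ _ (distribution P X)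
  (distribution P Y) (distribution P (pair_RV X Y))).
Qed.

Lemma ge0_integral_independent (X Y : {RV P >-> R}) (h : R * R -> \bar R) :
  independent_RV X Y -> measurable_fun setT h -> (forall z, 0 <= h z)%E ->
  (\int[P]_w h (X w, Y w) =
   \int[(distribution P X \x distribution P Y)%E]_z h z)%E.
Proof.
move=> XY mh h0; transitivity (\int[distribution P (pair_RV X Y)]_z h z)%E.
  by rewrite ge0_integral_distribution.
by apply: eq_measure_integral => A mA _; exact: independent_pair_distribution.
Qed.

Lemma integral_independent (X Y : {RV P >-> R}) (h : R * R -> \bar R) :
  independent_RV X Y ->
  (distribution P X \x distribution P Y)%E.-integrable setT h ->
  P.-integrable setT (fun w => h (X w, Y w)) /\
  (\int[P]_w h (X w, Y w) =
   \int[(distribution P X \x distribution P Y)%E]_z h z)%E.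
Proof.
move=> XY /integrableP[mh ih].
have ihXY : P.-integrable setT (fun w => h (X w, Y w)).
  apply/integrableP; split; first exact: (measurableT_comp mh).
  rewrite (ge0_integral_independent (h := fun z => `|h z|%E))//.
  exact: measurableT_comp.
split=> //; transitivity (\int[distribution P (pair_RV X Y)]_z h z)%E.
  by rewrite (integral_distribution (X := pair_RV X Y) mh).
by apply: eq_measure_integral => A mA _; exact: independent_pair_distribution.
Qed.

Lemma Lfun1_independentM (X Y : {RV P >-> R}) : independent_RV X Y ->
  (X : T -> R) \in Lfun P 1 -> (Y : T -> R) \in Lfun P 1 ->
  (X \* Y : T -> R) \in Lfun P 1 /\
  ('E_P[(X \* Y)%R] = 'E_P[X] * 'E_P[Y])%E.
Proof.
move=> XY /Lfun1_integrable iX /Lfun1_integrable iY.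
have distE (Z : {RV P >-> R}) : P.-integrable setT (EFin \o Z) ->
    (distribution P Z).-integrable setT (EFin \o id) /\
    (\int[distribution P Z]_x x%:E = 'E_P[Z])%E.
  move=> iZ; split; last by rewrite unlock (integral_distribution (X := Z)).
  apply/integrableP; split; first exact/measurable_EFinP.
  rewrite ge0_integral_distribution//; first by case/integrableP: iZ.
  by apply: measurableT_comp => //; exact/measurable_EFinP.
have [[iX' EX] [iY' EY]] := (distE _ iX, distE _ iY).
have [iprod Eprod] := integral_productM iX' iY'.
have [iXY EXY] := integral_independent XY iprod.
split; first exact/Lfun1_integrable.
by rewrite -EX -EY -Eprod unlock -EXY.
Qed.

Lemma expectation_bounded_independentM (d1 d2 : measure_display)
    (T1 : measurableType d1) (T2 : measurableType d2)
    (X : {RV P >-> T1}) (Y : {RV P >-> T2}) (f : T1 -> R) (g : T2 -> R)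
    (M N : R) : independent_RV X Y ->
  measurable_fun setT f -> measurable_fun setT g ->
  (forall x, `|f x| <= M) -> (forall y, `|g y| <= N) ->
  ('E_P[((f \o X) \* (g \o Y))%R] = 'E_P[f \o X] * 'E_P[g \o Y])%E.
Proof.
move=> XY mf mg fM gN.
pose fX : {RV P >-> R} :=
  mfun_Sub (mem_set (measurableT_comp mf (measurable_funPT X))).
pose gY : {RV P >-> R} :=
  mfun_Sub (mem_set (measurableT_comp mg (measurable_funPT Y))).
have fXgY : independent_RV fX gY := independent_RV_comp mf mg XY.
by have [] := Lfun1_independentM fXgY
  (bounded_Lfun1 P (measurable_funPT fX) (fun w => fM (X w)))
  (bounded_Lfun1 P (measurable_funPT gY) (fun w => gN (Y w))).
Qed.

Lemma variance_independentD (X Y : {RV P >-> R}) : independent_RV X Y ->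
  (X : T -> R) \in Lfun P 2%:E -> (Y : T -> R) \in Lfun P 2%:E ->
  ('V_P[(X \+ Y)%R] = 'V_P[X] + 'V_P[Y])%E.
Proof.
move=> XY X2 Y2; have [X1 Y1] := (Lfun2_Lfun1 X2, Lfun2_Lfun1 Y2).
have [XY1 EXY] := Lfun1_independentM XY X1 Y1.
rewrite varianceD// covarianceE// EXY subee ?mule0 ?adde0//.
by rewrite fin_numM// expectation_fin_num.
Qed.

Lemma expectation_independent_event (d1 d2 : measure_display)
    (T1 : measurableType d1) (T2 : measurableType d2)
    (X : {RV P >-> T1}) (Y : {RV P >-> T2}) (f : T2 -> R) (A : set T1) (M : R) :
  independent_RV X Y -> measurable_fun setT f -> (forall y, `|f y| <= M) ->
  measurable A ->
  ('E_P[((f \o Y) \* \1_(X @^-1` A))%R] = 'E_P[f \o Y] * P (X @^-1` A))%E.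
Proof.
move=> XY mf fM mA.
have mXA : measurable (X @^-1` A) by exact: measurable_preimage.
have m1A : measurable_fun setT (\1_A : T1 -> R) by exact: measurable_indic.
have := expectation_bounded_independentM (independent_RV_sym XY) mf m1A fM
  (fun x => normr_indic_le1 R A x).
by rewrite (_ : 'E_P[\1_A \o X] = P (X @^-1` A))%E// -expectation_indic.
Qed.

Lemma expectation_event_cvg (D : set T) (f_ : nat -> T -> R) (f : T -> R)
    (M : R) :
  measurable D -> (forall n, measurable_fun setT (f_ n)) ->
  measurable_fun setT f -> (forall n w, `|f_ n w| <= M) ->
  {ae P, forall w, f_ n w @[n --> \oo] --> f w} ->
  (forall n, 'E_P[(f_ n \* \1_D)%R] = 'E_P[f_ n] * P D)%E ->
  ('E_P[(f \* \1_D)%R] = 'E_P[f] * P D)%E.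
Proof.
move=> mD mf_ mf fM cf fD.
have m1D : measurable_fun setT (\1_D : T -> R) by exact: measurable_indic.
have cfD : ('E_P[(f_ n \* \1_D)%R] @[n --> \oo] --> 'E_P[(f \* \1_D)%R])%E.
  apply: (expectation_bounded_cvg (M := M)).
  - by move=> n; exact: measurable_funM.
  - exact: measurable_funM.
  - move=> n w; rewrite normrM -[leRHS]mulr1.
    by apply: ler_pM => //; exact: normr_indic_le1.
  - by apply: filterS cf => w cw; apply: cvgM => //; exact: cvg_cst.
have {}cf := expectation_bounded_cvg mf_ mf fM cf.
apply: cvg_unique cfD _ => //=; rewrite (eq_cvg _ _ fD).
by apply: cvgeZr => //; exact: fin_num_measure.
Qed.

Lemma independent_RV_cvg (d1 : measure_display) (T1 : measurableType d1)
    (X : {RV P >-> T1}) (Y_ : nat -> {RV P >-> R}) (Y : {RV P >-> R}) :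
  {ae P, forall w, Y_ n w @[n --> \oo] --> Y w} ->
  (forall n, independent_RV X (Y_ n)) -> independent_RV X Y.
Proof.
move=> cY XY; apply/independent_RV_sym => B A mB mA.
set D := X @^-1` A; have mD : measurable D by exact: measurable_preimage.
apply: independent_event_rays => // y.
have mr n : measurable_fun setT (ramp y n).
  by apply: continuous_measurable_fun; exact: continuous_ramp.
have r1 n x : `|ramp y n x| <= 1.
  by case/andP: (ramp01 y n x) => ? ?; rewrite ger0_norm.
have ramp_event n :
    ('E_P[((ramp y n \o Y) \* \1_D)%R] = 'E_P[ramp y n \o Y] * P D)%E.
  apply: (expectation_event_cvg (f_ := fun N => ramp y n \o Y_ N) (M := 1)).
  - by [].
  - by move=> N; exact: measurableT_comp.
  - exact: measurableT_comp.
  - by move=> N w; exact: r1.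
  - by apply: filterS cY => w; apply: continuous_cvg; exact: continuous_ramp.
  - by move=> N; exact: (expectation_independent_event (XY N) (mr n) (r1 n)).
set C := Y @^-1` _; have mC : measurable C by exact: measurable_preimage.
have := expectation_event_cvg (f_ := fun n => ramp y n \o Y) (f := \1_C) mD
  _ _ (fun n w => r1 n (Y w)) _ ramp_event.
rewrite -indicI !expectation_indic//; last exact: measurableI.
apply => //; first by move=> n; exact: measurableT_comp.
by apply: aeW => w; exact: ramp_cvg.
Qed.

End independent_pair.

Lemma law_independentD (R : realType) (d d' : measure_display)
    (T : measurableType d) (P : probability T R)
    (T' : measurableType d') (Q : probability T' R)
    (X Y : {RV P >-> R}) (X' Y' : {RV Q >-> R}) :
  independent_RV P X Y -> independent_RV Q X' Y' ->
  law P X = law Q X' -> law P Y = law Q Y' ->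
  law P (X \+ Y) = law Q (X' \+ Y').
Proof.
move=> XY XY' /law_eqP XX' /law_eqP YY'; apply/law_eqP => A mA.
have mD : measurable_fun setT (fun z : R * R => z.1 + z.2).
  exact: measurable_funD.
have mDA := measurable_preimage mD mA.
transitivity (P (pair_RV X Y @^-1` ((fun z => z.1 + z.2) @^-1` A))) => //.
rewrite independent_pair_distribution//.
apply: (@product_measure_unique _ _ _ _ _ (distribution P X)
  (distribution P Y) (distribution Q (pair_RV X' Y'))) => // B C mB mC.
by rewrite [LHS]XY'// -XX'// -YY'.
Qed.

Section independent_families.
Context (R : realType) (d : measure_display) (T : measurableType d).
Context (P : probability T R).
Implicit Types (X Y : nat -> {RV P >-> R}) (A : nat -> set R) (J K : set nat).

Lemma mutually_independentP X :
  mutually_independent X <->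
  forall n A, (forall k, measurable (A k)) ->
    (forall k, (n <= k)%N -> A k = setT) ->
    P (\bigcap_k (X k @^-1` A k)) = (\prod_(0 <= k < n) P (X k @^-1` A k))%E.
Proof.
split=> [iX n A mA AT|iX J A mA].
  have := iX [fset k in iota 0 n]%fset A mA.
  rewrite -bigcap_fset (_ : \bigcap_(k in _) _ = \bigcap_k X k @^-1` A k).
    move=> ->; apply: perm_big; apply: uniq_perm => [||k]; rewrite ?fset_uniq//.
      exact: iota_uniq.
    by rewrite inE /= /index_iota subn0.
  apply/seteqP; split=> w h k _; last exact: h.
  have [nk|kn] := leqP n k; first by rewrite /preimage/= AT.
  by apply: h; rewrite /= inE/= mem_iota.
pose n := (\max_(k <- J) k).+1; pose A' k := if k \in J then A k else setT.
have Jn k : k \in J -> (k < n)%N.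
  by move=> kJ; rewrite ltnS; exact: leq_bigmax_seq.
have mA' k : measurable (A' k) by rewrite /A'; case: ifP.
have A'T k : (n <= k)%N -> A' k = setT.
  rewrite leqNgt => nk; rewrite /A'.
  by case: ifP => // /Jn; rewrite (negbTE nk).
rewrite -bigcap_fset.
rewrite (_ : \bigcap_(k in _) _ = \bigcap_k X k @^-1` A' k); last first.
  apply/seteqP; split=> w h k => [_|kJ].
    by rewrite /A'; case: ifP => // kJ; exact: h.
  by have := h k I; rewrite /A' (_ : k \in J).
rewrite (iX n)//.
transitivity (\prod_(0 <= k < n | k \in J) P (X k @^-1` A k))%E.
  rewrite [RHS]big_mkcond/=; apply: eq_bigr => k _; rewrite /A'.
  by case: ifP => // _; rewrite preimage_setT; exact: probability_setT.
rewrite -big_filter; apply: perm_big; apply: uniq_perm => [||k].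
- by rewrite filter_uniq// iota_uniq.
- exact: fset_uniq.
- rewrite mem_filter mem_index_iota/=.
  by case: (boolP (k \in J)) => // /Jn ->.
Qed.

Lemma mutually_independent_comp X Y (g : nat -> R -> R) :
  (forall k, measurable_fun setT (g k)) -> (forall k w, Y k w = g k (X k w)) ->
  mutually_independent X -> mutually_independent Y.
Proof.
move=> mg Yg iX J A mA.
have YE k : Y k @^-1` A k = X k @^-1` (g k @^-1` A k).
  by apply/seteqP; split => w /=; rewrite Yg.
under eq_bigr do rewrite YE; under [RHS]eq_bigr do rewrite YE.
by apply: iX => k; exact: measurable_preimage.
Qed.

Lemma mutually_independent_reindex X (r : nat -> nat) : injective r ->
  mutually_independent X -> mutually_independent (fun k => X (r k)).
Proof.
move=> rI iX J A mA.
pose A' j := A (xget 0%N [set k | r k = j]).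
have A'E k : A' (r k) = A k.
  congr A; apply: (rI).
  exact: (@xgetPex _ 0%N [set j | r j = r k] (ex_intro _ k erefl)).
have := iX [fset r k | k in J]%fset A' (fun j => mA _).
rewrite !big_imfset/=; try by move=> ? ? _ _ /rI.
under eq_bigr do rewrite A'E; under [in X in _ = X]eq_bigr do rewrite A'E.
by [].
Qed.

Definition cylinder X J : set (set T) := [set E | exists n A,
  [/\ forall k, measurable (A k),
      forall k, (n <= k)%N \/ ~ J k -> A k = setT &
      E = \bigcap_k (X k @^-1` A k)]].

Definition adapted X J (W : T -> R) : Prop :=
  measurable_fun [set: g_sigma_algebraType (cylinder X J)] W.

Lemma cylinder_setT X J : cylinder X J setT.
Proof.
exists 0%N, (fun=> setT); split => //.
by apply/seteqP; split => // w _ k _; rewrite preimage_setT.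
Qed.

Lemma cylinder_setI X J : setI_closed (cylinder X J).
Proof.
move=> _ _ [n1 [A1 [mA1 A1T ->]]] [n2 [A2 [mA2 A2T ->]]].
exists (maxn n1 n2), (fun k => A1 k `&` A2 k); split.
- by move=> k; exact: measurableI.
- move=> k; rewrite geq_max => -[/andP[n1k n2k]|nJk].
    by rewrite A1T ?A2T ?setTI//; left.
  by rewrite A1T ?A2T ?setTI//; right.
- by rewrite -bigcapI; apply: eq_bigcapr => k _; rewrite preimage_setI.
Qed.

Lemma cylinder_measurable X J : cylinder X J `<=` measurable.
Proof.
move=> _ [n [A [mA _ ->]]]; apply: bigcapT_measurable => k.
exact: measurable_preimage.
Qed.

Lemma adapted_measurable X J W : adapted X J W -> measurable_fun setT W.
Proof.
move=> aW _ B mB; have := aW measurableT B mB.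
apply: smallest_sub; first exact: sigma_algebra_measurable.
exact: cylinder_measurable.
Qed.

Lemma adapted_subset X J K W : J `<=` K -> adapted X J W -> adapted X K W.
Proof.
move=> JK aW _ B mB; have := aW measurableT B mB.
apply: smallest_sub; first exact: smallest_sigma_algebra.
move=> _ [n [A [mA AT ->]]]; apply: sub_sigma_algebra.
by exists n, A; split => // k [nk|Kk]; apply: AT; [left|right => /JK].
Qed.

Lemma adapted_coord X J k : J k -> adapted X J (X k).
Proof.
move=> Jk _ B mB; rewrite setTI; apply: sub_sigma_algebra.
exists k.+1, (fun j => if j == k then B else setT); split.
- by move=> j; case: ifP.
- by move=> j; case: eqP => // -> []; rewrite ?ltnn.
- apply/seteqP; split => [w Bw j _|w /(_ k I)]; rewrite /= ?eqxx//.
  by case: eqP => // ->.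
Qed.

Lemma adapted_sum X J (s : seq nat) (W : nat -> T -> R) :
  (forall k, k \in s -> adapted X J (W k)) ->
  adapted X J (fun w => \sum_(k <- s) W k w).
Proof.
elim: s => [|k s IH] aW.
  by under [X in adapted _ _ X]eq_fun do rewrite big_nil; exact: measurable_cst.
under [X in adapted _ _ X]eq_fun do rewrite big_cons.
apply: measurable_funD; first by apply: aW; rewrite mem_head.
by apply: IH => j js; apply: aW; rewrite inE js orbT.
Qed.

Lemma independent_event_sigma (G : set (set T)) (D : set T) :
  setI_closed G -> G setT -> G `<=` measurable -> measurable D ->
  (forall E, G E -> P (E `&` D) = (P E * P D)%E) ->
  forall E, <<s G >> E -> P (E `&` D) = (P E * P D)%E.
Proof.
move=> GI GT mG mD GD E sE.
have [p p0 PD] : exists2 p, 0 <= p & P D = p%:E.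
  by exists (fine (P D)); rewrite ?fine_ge0 ?fineK ?fin_num_measure.
rewrite PD muleC.
apply: (@g_sigma_algebra_measure_unique d R T G mG (fun=> setT) _ _
  (mrestr P mD) (mscale (NngNum p0) P)) => //.
- by apply/seteqP; split => // w _; exists 0%N.
- by move=> F GF; rewrite [LHS]GD// PD muleC.
- move=> _; apply: le_lt_trans (probability_le1 P _) (ltry _).
  exact: measurableI.
Qed.

Lemma cylinder_independent X J K E F : mutually_independent X ->
  (forall k, J k -> ~ K k) -> cylinder X J E -> cylinder X K F ->
  P (E `&` F) = (P E * P F)%E.
Proof.
move=> /mutually_independentP iX JK.
move=> [n1 [A1 [mA1 A1T ->]]] [n2 [A2 [mA2 A2T ->]]].
rewrite -bigcapI; pose n := maxn n1 n2.
have A1n k : (n <= k)%N -> A1 k = setT.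
  by rewrite geq_max => /andP[nk _]; apply: A1T; left.
have A2n k : (n <= k)%N -> A2 k = setT.
  by rewrite geq_max => /andP[_ nk]; apply: A2T; left.
transitivity (P (\bigcap_k (X k @^-1` (A1 k `&` A2 k)))).
  by congr (P _); apply: eq_bigcapr => k _; rewrite preimage_setI.
rewrite (iX n)//; last 2 first.
- by move=> k; exact: measurableI.
- by move=> k nk; rewrite A1n// A2n// setTI.
rewrite (iX n)// (iX n)// -big_split/=; apply: eq_bigr => k _.
have [Jk|nJk] := pselect (J k).
  rewrite A2T; last by right; exact: JK.
  by rewrite setIT preimage_setT [P setT]probability_setT mule1.
rewrite A1T; last by right.
by rewrite setTI preimage_setT [P setT]probability_setT mul1e.
Qed.

Lemma independent_adapted X J K (V W : T -> R) : mutually_independent X ->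
  (forall k, J k -> ~ K k) -> adapted X J V -> adapted X K W ->
  independent_RV P V W.
Proof.
move=> iX JK aV aW A B mA mB.
have sV : <<s cylinder X J >> (V @^-1` A).
  by have := aV measurableT A mA; rewrite setTI.
have sW : <<s cylinder X K >> (W @^-1` B).
  by have := aW measurableT B mB; rewrite setTI.
have mV : measurable (V @^-1` A).
  by apply: measurable_preimage => //; exact: adapted_measurable aV.
have cyl_setI := @cylinder_setI X; have cylT := @cylinder_setT X.
have mcyl := @cylinder_measurable X.
apply: (independent_event_sigma (cyl_setI J) (cylT J) (mcyl J)) => //.
  by apply: measurable_preimage => //; exact: adapted_measurable aW.
move=> E JE; have mE := mcyl _ _ JE; rewrite setIC muleC.
apply: (independent_event_sigma (cyl_setI K) (cylT K) (mcyl K)) => //.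
move=> F KF; rewrite setIC muleC; exact: cylinder_independent JE KF.
Qed.

End independent_families.

(** * Sums of independent square-integrable variables *)

Section partial_sum.
Context (R : realType) (d : measure_display) (T : measurableType d).
Context (P : probability T R).
Implicit Types (X : nat -> {RV P >-> R}).

Definition partial_sum X n (w : T) : R := \sum_(0 <= k < n) X k w.

Let measurable_partial_sum X n : measurable_fun setT (partial_sum X n).
Proof. exact: measurable_sum. Qed.

HB.instance Definition _ X n := isMeasurableFun.Build _ _ _ _
  (partial_sum X n) (measurable_partial_sum X n).

Lemma partial_sum0 X : partial_sum X 0 = cst 0.
Proof. by apply/funext => w; rewrite /partial_sum big_geq. Qed.

Lemma partial_sumS X n : partial_sum X n.+1 = partial_sum X n \+ X n.
Proof. by apply/funext => w; rewrite /partial_sum big_nat_recr. Qed.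

Lemma partial_sumB X m n w : (m <= n)%N ->
  partial_sum X n w - partial_sum X m w = \sum_(m <= k < n) X k w.
Proof.
by move=> mn; rewrite /partial_sum (big_cat_nat _ mn)//= addrAC subrr add0r.
Qed.

Lemma partial_sum_shift X N k w :
  partial_sum (fun j => X (N + j)%N) k w =
  partial_sum X (N + k) w - partial_sum X N w.
Proof. by rewrite partial_sumB ?leq_addr// big_nat_shift. Qed.

Lemma adapted_partial_sum X n : adapted X `I_n (partial_sum X n).
Proof.
by apply: adapted_sum => k; rewrite mem_index_iota => kn; exact: adapted_coord.
Qed.

Lemma partial_sum_independent X n : mutually_independent X ->
  independent_RV P (partial_sum X n) (X n).
Proof.
move=> iX; apply: (independent_adapted (J := `I_n) (K := [set n]) iX).
- by move=> k /= kn nk; move: kn; rewrite nk ltnn.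
- exact: adapted_partial_sum.
- exact: adapted_coord.
Qed.

Lemma partial_sum_remainder_independent X (S : {RV P >-> R}) n :
  mutually_independent X ->
  {ae P, forall w, partial_sum X m w @[m --> \oo] --> S w} ->
  independent_RV P (partial_sum X n) (S \- partial_sum X n).
Proof.
move=> iX cS.
apply: (independent_RV_cvg
  (Y_ := fun m => partial_sum X (n + m) \- partial_sum X n)
  (Y := S \- partial_sum X n)).
  apply: filterS cS => w cw; apply: cvgB; last exact: cvg_cst.
  by move: cw; rewrite -(cvg_shiftn n); under eq_fun do rewrite addnC.
move=> m; apply: (independent_adapted (J := `I_n)
  (K := [set k | (n <= k)%N]) iX).
- by move=> k /= kn; rewrite leqNgt kn.
- exact: adapted_partial_sum.
- have aX k : k \in index_iota n (n + m) ->
      adapted X [set k | (n <= k)%N] (X k).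
    by rewrite mem_index_iota => /andP[nk _]; exact: adapted_coord.
  have := adapted_sum (W := fun k => X k) aX.
  by congr adapted; apply/funext => w; rewrite /= partial_sumB// leq_addr.
Qed.

Lemma Lfun2_partial_sum X n : (forall k, (X k : T -> R) \in Lfun P 2%:E) ->
  (partial_sum X n : T -> R) \in Lfun P 2%:E.
Proof.
move=> X2; elim: n => [|n IH].
  by rewrite partial_sum0 Lfun_cst.
by rewrite partial_sumS rpredD ?lee1n.
Qed.

Lemma expectation_partial_sum0 X n :
  (forall k, (X k : T -> R) \in Lfun P 2%:E) ->
  (forall k, 'E_P[X k]%E = 0%E) -> 'E_P[partial_sum X n]%E = 0%E.
Proof.
move=> X2 EX; elim: n => [|n IH].
  by rewrite partial_sum0 expectation_cst.
rewrite partial_sumS expectationD ?Lfun2_Lfun1 ?Lfun2_partial_sum//.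
by rewrite IH EX adde0.
Qed.

Lemma variance_partial_sum X n : mutually_independent X ->
  (forall k, (X k : T -> R) \in Lfun P 2%:E) ->
  ('V_P[partial_sum X n] = \sum_(0 <= k < n) 'V_P[X k])%E.
Proof.
move=> iX X2; elim: n => [|n IH].
  by rewrite big_geq// partial_sum0 variance_cst.
rewrite partial_sumS big_nat_recr//= -IH.
apply: variance_independentD => //; last exact: Lfun2_partial_sum.
exact: partial_sum_independent.
Qed.

End partial_sum.

Lemma law_partial_sum (R : realType) (d d' : measure_display)
    (T : measurableType d) (P : probability T R)
    (T' : measurableType d') (Q : probability T' R)
    (X : nat -> {RV P >-> R}) (Y : nat -> {RV Q >-> R}) n :
  mutually_independent X -> mutually_independent Y ->
  (forall k, law P (X k) = law Q (Y k)) ->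
  law P (partial_sum X n) = law Q (partial_sum Y n).
Proof.
move=> iX iY XY; elim: n => [|n IH].
  apply/law_eqP => A mA; rewrite !partial_sum0 !preimage_cst.
  case: ifP => _; last by rewrite !measure0.
  by rewrite [LHS]probability_setT [RHS]probability_setT.
rewrite !partial_sumS; apply: law_independentD => //;
  exact: partial_sum_independent.
Qed.

Section centered_independent.
Context (R : realType) (d : measure_display) (T : measurableType d).
Context (P : probability T R).
Implicit Types (X : nat -> {RV P >-> R}) (v : nat -> R).

Definition centered_independent X v : Prop :=
  [/\ mutually_independent X, forall k, (X k : T -> R) \in Lfun P 2%:E,
      forall k, 'E_P[X k]%E = 0%E & forall k, 'V_P[X k]%E = (v k)%:E].

Lemma centered_independent_reindex X v (r : nat -> nat) : injective r ->
  centered_independent X v -> centered_independent (fun k => X (r k)) (v \o r).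
Proof.
by move=> rI [iX X2 EX VX]; split => //; exact: mutually_independent_reindex.
Qed.

Lemma centered_independent_variance_ge0 X v k :
  centered_independent X v -> 0 <= v k.
Proof. by move=> [_ _ _ VX]; rewrite -lee_fin -VX variance_ge0. Qed.

Definition martingale_transform (H : nat -> T -> R) X n (w : T) : R :=
  \sum_(0 <= k < n) H k w * X k w.

Section bounded_multiplier.
Variables (X : nat -> {RV P >-> R}) (v : nat -> R).
Variables (H : nat -> T -> R) (h : nat -> R).
Hypothesis Xv : centered_independent X v.
Hypothesis aH : forall k, adapted X `I_k (H k).
Hypothesis Hh : forall k w, `|H k w| <= h k.

Let mt := martingale_transform H X.

Let mt0 : mt 0 = cst 0.
Proof. by apply/funext => w; rewrite /mt/martingale_transform big_geq. Qed.

Let mtS n : mt n.+1 = mt n \+ (fun w => H n w * X n w).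
Proof. by apply/funext => w; rewrite /mt/martingale_transform big_nat_recr. Qed.

Let mH k : measurable_fun setT (H k).
Proof. exact: adapted_measurable (@aH k). Qed.

Let HX_Lfun2 k : (fun w => H k w * X k w) \in Lfun P 2%:E.
Proof. by case: Xv => _ X2 _ _; exact: Lfun2M_bounded (X2 k) (mH k) (Hh k). Qed.

Lemma Lfun2_martingale_transform n : mt n \in Lfun P 2%:E.
Proof.
elim: n => [|n IH]; first by rewrite mt0 Lfun_cst.
by rewrite mtS rpredD ?lee1n.
Qed.

Lemma adapted_martingale_transform n : adapted X `I_n (mt n).
Proof.
apply: (adapted_sum (W := fun k w => H k w * X k w)) => k.
rewrite mem_index_iota => /= kn; apply: measurable_funM.
  by apply: adapted_subset (@aH k) => j /= jk; exact: ltn_trans kn.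
exact: adapted_coord.
Qed.

Lemma expectation_adaptedM_centered n (W : T -> R) :
  adapted X `I_n W -> W \in Lfun P 1 -> 'E_P[(W \* X n)%R]%E = 0%E.
Proof.
case: Xv => iX X2 EX _ aW W1.
pose W' : {RV P >-> R} := mfun_Sub (mem_set (Lfun_measurable W1)).
have WX : independent_RV P W' (X n).
  apply: (independent_adapted (J := `I_n) (K := [set n]) iX) => //.
    by move=> k /= kn nk; move: kn; rewrite nk ltnn.
  exact: adapted_coord.
have [_ ->] := Lfun1_independentM WX W1 (Lfun2_Lfun1 (X2 n)).
by rewrite EX mule0.
Qed.

Lemma expectation_martingale_transform n : 'E_P[mt n]%E = 0%E.
Proof.
elim: n => [|n IH]; first by rewrite mt0 expectation_cst.
rewrite mtS expectationD ?IH ?Lfun2_Lfun1 ?Lfun2_martingale_transform//.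
rewrite add0e; apply: expectation_adaptedM_centered => //.
exact: bounded_Lfun1 (Hh n).
Qed.

Lemma variance_multiplier_le k :
  ('V_P[(fun w => (H k w * X k w)%R)] <= (h k ^+ 2 * v k)%:E)%E.
Proof.
case: (Xv) => _ X2 EX VX.
have HX0 : 'E_P[(fun w => (H k w * X k w)%R)]%E = 0%E.
  by apply: expectation_adaptedM_centered => //; exact: bounded_Lfun1 (Hh k).
rewrite variance_centered// EFinM -VX variance_centered//.
rewrite -integralZl//; last exact: Lfun2_integrable_sqr.
have mX2 : measurable_fun setT (fun w => X k w ^+ 2) by exact: measurable_funX.
apply: ge0_le_integral => //.
- by move=> w _; rewrite lee_fin sqr_ge0.
- by apply/measurable_EFinP; apply: measurable_funX; exact: measurable_funM.
- by apply: measurable_funeM; exact/measurable_EFinP.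
- move=> w _; rewrite -EFinM lee_fin exprMn ler_wpM2r ?sqr_ge0//.
  rewrite -[leLHS]real_normK ?num_real// lerXn2r ?nnegrE//.
  exact: le_trans (Hh k w).
Qed.

Lemma variance_martingale_transform_le n :
  ('V_P[mt n] <= (\sum_(0 <= k < n) h k ^+ 2 * v k)%:E)%E.
Proof.
elim: n => [|n IH]; first by rewrite big_geq// mt0 variance_cst.
have M2 := Lfun2_martingale_transform n.
have MH1 : (mt n \* H n) \in Lfun P 1.
  rewrite (_ : _ \* _ = fun w => H n w * mt n w); last first.
    by apply/funext => w; rewrite /= mulrC.
  by apply: Lfun2_Lfun1; exact: Lfun2M_bounded (Hh n).
have cov0 : covariance P (mt n) (fun w => H n w * X n w) = 0%E.
  rewrite covarianceE; [|exact: Lfun2_Lfun1..|exact: Lfun2_mul_Lfun1].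
  rewrite expectation_martingale_transform mul0e sube0.
  rewrite (_ : _ * _ = (mt n \* H n) \* X n); last first.
    by apply/funext => w; rewrite /= mulrA.
  apply: expectation_adaptedM_centered MH1.
  by apply: measurable_funM; [exact: adapted_martingale_transform|exact: aH].
rewrite mtS varianceD// cov0 mule0 adde0 big_nat_recr//= [leRHS]EFinD.
by rewrite leeD// variance_multiplier_le.
Qed.

End bounded_multiplier.

End centered_independent.

Section kolmogorov.
Context (R : realType) (d : measure_display) (T : measurableType d).
Context (P : probability T R).
Implicit Types (X : nat -> {RV P >-> R}) (v : nat -> R) (e : R).

Definition confined X e n : set T :=
  [set w | forall k, (k <= n)%N -> `|partial_sum X k w| < e].

Lemma confinedE X e n :
  confined X e n = \bigcap_(k in `I_n.+1) (partial_sum X k @^-1` `]- e, e[).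
Proof.
apply/seteqP; split=> w h k kn; first by rewrite /= in_itv/= -ltr_norml h.
by have := h k kn; rewrite /= in_itv/= -ltr_norml.
Qed.

Lemma sigma_confined X e n : <<s cylinder X `I_n >> (confined X e n).
Proof.
rewrite confinedE.
apply: (@bigcap_measurable _ (g_sigma_algebraType (cylinder X `I_n))).
  by exists 0%N => /=.
move=> k /= kn; rewrite -[X in measurable X]setTI.
have aS : adapted X `I_n (partial_sum X k).
  apply: adapted_subset (@adapted_partial_sum _ _ _ _ X k) => j /= jk.
  exact: leq_trans jk _.
exact: aS.
Qed.

Lemma measurable_confined X e n : measurable (confined X e n).
Proof.
rewrite confinedE; apply: bigcap_measurable; first by exists 0%N => /=.
by move=> k _; exact: measurable_preimage.
Qed.

(* Multiplying by the indicators of confinement stops the sum at its first exit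
   from ]-e, e[. *)
Lemma martingale_transform_exit X e n w : ~ confined X e n w ->
  e <= `|martingale_transform (fun k => \1_(confined X e k)) X n w|.
Proof.
move=> nc; have ex : exists k, (k <= n)%N && (e <= `|partial_sum X k w|).
  apply: contrapT => /forallNP h; apply: nc => k kn.
  by have /negP := h k; rewrite kn/= -ltNge.
case: (ex_minnP ex) => k /andP[kn ek] kmin.
suff -> : martingale_transform (fun k => \1_(confined X e k)) X n w =
    partial_sum X k w by [].
rewrite /martingale_transform (big_cat_nat (leq0n k) kn)/=.
rewrite [X in _ + X]big_nat_cond [X in _ + X]big1 ?addr0 => [|j]; last first.
  rewrite andbT => /andP[kj _]; rewrite indicE memNset ?mul0r// => /(_ k kj).
  by rewrite ltNge ek.
apply: eq_big_nat => j /andP[_ jk]; rewrite indicE mem_set ?mul1r// => i ij.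
rewrite ltNge; apply/negP => ei; have ik := leq_ltn_trans ij jk.
by have := kmin i; rewrite (leq_trans (ltnW ik) kn) ei leqNgt ik => /(_ isT).
Qed.

Lemma kolmogorov_inequality X v e n : centered_independent X v -> 0 < e ->
  (P (~` confined X e n) <= ((\sum_(0 <= k < n) v k) / e ^+ 2)%:E)%E.
Proof.
move=> Xv e0; pose H k : T -> R := \1_(confined X e k).
have aH k : adapted X `I_k (H k).
  apply: (@measurable_indic _ (g_sigma_algebraType (cylinder X `I_k))).
  exact: sigma_confined.
have H1 k w : `|H k w| <= 1 by exact: normr_indic_le1.
have M2 := Lfun2_martingale_transform Xv aH H1 n.
pose M : {RV P >-> R} := mfun_Sub (mem_set (Lfun_measurable M2)).
have EM : 'E_P[M]%E = 0%E := expectation_martingale_transform Xv aH H1 n.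
have := chebyshev M e0; rewrite EM; under eq_set do rewrite subr0.
move=> exit_le; apply: le_trans (le_trans exit_le _).
  apply: le_measure; rewrite ?inE.
  - exact/measurableC/measurable_confined.
  - rewrite (_ : mkset _ = ~` (M @^-1` `]- e, e[)).
      by apply: measurableC; exact: measurable_preimage.
    apply/seteqP; split=> w /=; rewrite in_itv/= -ltr_norml leNgt => /negP //.
  - by move=> w /martingale_transform_exit.
rewrite [_ / _]mulrC EFinM lee_wpmul2l//.
  by rewrite lee_fin invr_ge0 exprn_ge0// ltW.
apply: le_trans (variance_martingale_transform_le Xv aH H1 n) _.
by under eq_bigr do rewrite expr1n mul1r.
Qed.

Lemma kolmogorov_inequality_sup X v e B : centered_independent X v -> 0 < e ->
  (forall n, \sum_(0 <= k < n) v k <= B) ->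
  (P (~` \bigcap_n confined X e n) <= (B / e ^+ 2)%:E)%E.
Proof.
move=> Xv e0 vB; rewrite setC_bigcap.
have mC n : measurable (~` confined X e n).
  exact/measurableC/measurable_confined.
have cP :
    P (~` confined X e n) @[n --> \oo] --> P (\bigcup_n ~` confined X e n).
  apply: nondecreasing_cvg_mu => //; first exact: bigcupT_measurable.
  move=> m n mn; apply/subsetPset; apply: subsetC => w cw k km.
  by apply: cw; exact: leq_trans mn.
rewrite -(cvg_lim _ cP)//; apply: lime_le.
  by apply/cvg_ex; eexists; exact: cP.
apply: nearW => n; apply: le_trans (kolmogorov_inequality n Xv e0) _.
by rewrite lee_fin ler_wpM2r// invr_ge0 exprn_ge0// ltW.
Qed.

Lemma cvgn_partial_sum_confined X w :
  (forall m, exists N, forall n,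
    confined (fun k => X (N + k)%N) m.+1%:R^-1 n w) ->
  cvgn (partial_sum X ^~ w).
Proof.
move=> cw; apply/cauchy_cvgP/cauchy_seriesP => e e0.
have e2 : 0 < e / 2 by rewrite divr_gt0.
have [m] := ltr_add_invr e2; rewrite add0r => me; have [N cN] := cw m.
have tail k : (N <= k)%N -> `|partial_sum X k w - partial_sum X N w| < e / 2.
  move=> /subnKC <-; rewrite -partial_sum_shift; apply: lt_trans me.
  exact: (cN (k - N)%N).
exists ([set n | (N <= n)%N], [set n | (N <= n)%N]); first by split; exists N.
move=> [a b] /= [Na Nb]; have [ba|/ltnW ab] := leqP b a.
  by rewrite big_geq// normr0.
rewrite -partial_sumB//.
apply: le_lt_trans (ler_distD (partial_sum X N w) _ _) _.
by rewrite [ltRHS]splitr ltrD ?tail// distrC tail.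
Qed.

Lemma kolmogorov_cvg X v : centered_independent X v -> cvgn (series v) ->
  {ae P, forall w, cvgn (partial_sum X ^~ w)}.
Proof.
move=> Xv cv.
have v0 k : 0 <= v k := centered_independent_variance_ge0 k Xv.
pose F N m := ~` \bigcap_n confined (fun k => X (N + k)%N) m.+1%:R^-1 n.
have mF N m : measurable (F N m).
  apply: measurableC; apply: bigcapT_measurable => n.
  exact: measurable_confined.
have PF N m :
    (P (F N m) <= ((limn (series v) - series v N) * m.+1%:R ^+ 2)%:E)%E.
  have := kolmogorov_inequality_sup (e := m.+1%:R^-1)
    (B := limn (series v) - series v N)
    (centered_independent_reindex (@addnI N) Xv).
  rewrite exprVn invrK; apply => [|n]; first by rewrite invr_gt0.
  exact: sum_tail_le.
have null m : P.-negligible (\bigcap_N F N m).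
  exists (\bigcap_N F N m); split => //; first exact: bigcapT_measurable.
  apply/eqP; rewrite eq_le measure_ge0 andbT.
  have cB :
      ((limn (series v) - series v N) * m.+1%:R ^+ 2)%:E @[N --> \oo] --> 0%E.
    apply: cvg_EFin; first exact: nearW.
    rewrite -[X in _ --> X](mul0r (m.+1%:R ^+ 2 : R)).
    rewrite -(subrr (limn (series v))).
    by apply: cvgM; [apply: cvgB => //; exact: cvg_cst|exact: cvg_cst].
  rewrite -(cvg_lim _ cB)//; apply: lime_ge.
    by apply/cvg_ex; eexists; exact: cB.
  apply: nearW => N; apply: le_trans (PF N m).
  apply: le_measure; rewrite ?inE//.
    exact: bigcapT_measurable.
  by move=> w; exact.
apply: negligibleS (negligible_bigcup null) => w ncv.
apply: contrapT => nF; apply: ncv; apply: cvgn_partial_sum_confined => m.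
apply: contrapT => /forallNP nc; apply: nF; exists m => // N _ cN.
by apply: (nc N) => n; exact: cN.
Qed.

End kolmogorov.

Section centered_limit.
Context (R : realType) (d : measure_display) (T : measurableType d).
Context (P : probability T R).
Implicit Types (X : nat -> {RV P >-> R}) (S : {RV P >-> R}) (v : nat -> R).

Lemma ae_limit_exists (X_ : nat -> T -> R) :
  (forall n, measurable_fun setT (X_ n)) ->
  {ae P, forall w, cvgn (X_ ^~ w)} ->
  exists S, {ae P, forall w, X_ n w @[n --> \oo] --> S w}.
Proof.
move=> mX [N [mN PN XN]].
pose Y n w := X_ n w * \1_(~` N) w.
have cY w : Y n w @[n --> \oo] --> limn (Y ^~ w).
  have [Nw|Nw] := pselect (N w).
    rewrite (_ : Y ^~ w = fun=> 0); first exact: is_cvg_cst.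
    by apply/funext => n; rewrite /Y indicE memNset ?mulr0//; exact.
  apply: is_cvgM; last exact: is_cvg_cst.
  by apply: contrapT => /XN.
have mY : measurable_fun setT (fun w => limn (Y ^~ w)).
  apply: (@measurable_fun_cvg _ _ _ _ Y) => // n.
  by apply: measurable_funM => //; apply: measurable_indic; exact: measurableC.
exists (mfun_Sub (mem_set mY)); exists N; split => // w /= ncv.
apply: contrapT => Nw; apply: ncv; apply: cvg_trans (cY w).
apply: near_eq_cvg; apply: nearW => n.
by rewrite /Y indicE mem_set// mulr1.
Qed.

Lemma centered_sum_exists X v : centered_independent X v -> cvgn (series v) ->
  exists S, {ae P, forall w, partial_sum X n w @[n --> \oo] --> S w}.
Proof.
by move=> Xv cv; apply: ae_limit_exists => //; exact: kolmogorov_cvg Xv cv.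
Qed.

Lemma second_moment_unused_indices X v (r : nat -> nat) n N :
  centered_independent X v -> injective r ->
  (forall k, (k < n)%N -> (r k < N)%N) ->
  (\int[P]_w
     ((partial_sum X N w - partial_sum (fun k => X (r k)) n w) ^+ 2)%:E <=
   (series v N - series (v \o r) n)%:E)%E.
Proof.
move=> Xv rI rN.
pose H k (w : T) : R := (unused_indices r n k)%:R.
have aH k : adapted X `I_k (H k) by exact: measurable_cst.
have Hh k w : `|H k w| <= (unused_indices r n k)%:R by rewrite ger0_norm.
have transformE : martingale_transform H X N =
    fun w => partial_sum X N w - partial_sum (fun k => X (r k)) n w.
  apply/funext => w; exact: (sum_unused_indices (fun k => X k w) rI rN).
have M2 := Lfun2_martingale_transform Xv aH Hh N.
have EM := expectation_martingale_transform Xv aH Hh N.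
have := variance_martingale_transform_le Xv aH Hh N.
rewrite variance_centered// transformE => /le_trans; apply.
rewrite lee_fin -(sum_unused_indices _ rI rN); apply: ler_sum => k _.
by case: unused_indices; rewrite ?expr1n// expr0n.
Qed.

Lemma second_moment_rearrangement_remainder X v (r : nat -> nat) S n :
  centered_independent X v -> cvgn (series v) -> injective r ->
  {ae P, forall w, partial_sum X m w @[m --> \oo] --> S w} ->
  (\int[P]_w ((S w - partial_sum (fun k => X (r k)) n w) ^+ 2)%:E <=
   (limn (series v) - series (v \o r) n)%:E)%E.
Proof.
move=> Xv cv rI cS; have [M rM] := rearrangement_bound r n.
apply: (fatou_second_moment (X_ := fun N w =>
  partial_sum X N w - partial_sum (fun k => X (r k)) n w)).
- by move=> N; exact: measurable_funB.
- exact: measurable_funB.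
- by apply: filterS cS => w cw; apply: cvgB => //; exact: cvg_cst.
exists M => // N /= MN.
apply: le_trans (second_moment_unused_indices Xv rI _) _ => [k /rM rk|].
  exact: leq_trans MN.
rewrite lee_fin lerD2r; apply: nondecreasing_cvgn_le => //.
apply: nondecreasing_series => k _ _.
exact: centered_independent_variance_ge0 Xv.
Qed.

Lemma centered_sum_Lfun2 X v S : centered_independent X v ->
  cvgn (series v) ->
  {ae P, forall w, partial_sum X n w @[n --> \oo] --> S w} ->
  (S : T -> R) \in Lfun P 2%:E.
Proof.
move=> Xv cv cS.
have := second_moment_rearrangement_remainder 0 Xv cv (@inj_id nat) cS.
move=> /le_lt_trans/(_ (ltry _)) S2; apply: Lfun2P => //.
apply: le_lt_trans S2; rewrite le_eqVlt; apply/orP; left; apply/eqP.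
by apply: eq_integral => w _; rewrite /partial_sum big_geq// subr0.
Qed.

(* The mean of S is that of S - S_n, whose second moment tends to 0. *)
Lemma centered_sum_expectation X v S : centered_independent X v ->
  cvgn (series v) ->
  {ae P, forall w, partial_sum X n w @[n --> \oo] --> S w} ->
  'E_P[S]%E = 0%E.
Proof.
move=> Xv cv cS; have [_ X2 EX _] := Xv.
have S2 := centered_sum_Lfun2 Xv cv cS.
have ES n : ('E_P[S] = 'E_P[(S \- partial_sum X n)%R])%E.
  have Sn2 := Lfun2_partial_sum n X2.
  by rewrite expectationB ?Lfun2_Lfun1// expectation_partial_sum0// sube0.
have ESfin : 'E_P[S]%E \is a fin_num.
  by rewrite expectation_fin_num ?Lfun2_Lfun1.
have tail_cvg : limn (series v) - series v n @[n --> \oo] --> (0 : R).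
  by rewrite -(subrr (limn (series v))); apply: cvgB => //; exact: cvg_cst.
apply/eqP; rewrite -[X in X == _]fineK// eqe -sqrf_eq0 eq_le sqr_ge0 andbT.
rewrite -(cvg_lim _ tail_cvg)//; apply: limr_ge; first exact: cvgP tail_cvg.
apply: nearW => n; rewrite -lee_fin EFin_expe fineK// (ES n).
apply: le_trans
  (second_moment_rearrangement_remainder n Xv cv (@inj_id nat) cS).
apply: (sqr_expectation_le (X := S \- partial_sum X n)).
by rewrite rpredB ?lee1n// => one_le2; exact: Lfun2_partial_sum.
Qed.

Lemma rearranged_sum_ae_eq X v (r : nat -> nat) S S' :
  centered_independent X v -> cvgn (series v) -> injective r ->
  (forall k, 0 < v k -> exists n, r n = k) ->
  {ae P, forall w, partial_sum X n w @[n --> \oo] --> S w} ->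
  {ae P, forall w, partial_sum (fun k => X (r k)) n w @[n --> \oo] --> S' w} ->
  {ae P, forall w, S w = S' w}.
Proof.
move=> Xv cv rI hit cS cS'.
have v0 k : 0 <= v k := centered_independent_variance_ge0 k Xv.
have cvr := cvg_series_rearrangement v0 cv rI hit.
suff S_S'0 : (\int[P]_w ((S w - S' w) ^+ 2)%:E <= 0)%E.
  have mSS' : measurable_fun setT (fun w => S w - S' w).
    exact: measurable_funB.
  apply: filterS (ae_eq0_second_moment mSS' S_S'0) => w /eqP.
  by rewrite subr_eq0 => /eqP.
apply/lee_addgt0Pr => e e0; rewrite add0e.
apply: (fatou_second_moment (X_ := fun n w =>
  S w - partial_sum (fun k => X (r k)) n w)).
- by move=> n; exact: measurable_funB.
- exact: measurable_funB.
- by apply: filterS cS' => w cw; apply: cvgB => //; exact: cvg_cst.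
have : \forall n \near \oo, `|limn (series v) - series (v \o r) n| < e.
  exact: (@cvgr_dist_lt _ _ _ _ _ _ _ cvr).
apply: filterS => n ltn.
apply: le_trans (second_moment_rearrangement_remainder n Xv cv rI cS) _.
by rewrite lee_fin ltW// (le_lt_trans (ler_norm _)).
Qed.

End centered_limit.

(** * Cardinal sines *)

Section sinc.
Context (R : realType).
Implicit Types (x y : R).

Lemma sin_mean_value x : 0 <= x -> exists2 c, 0 <= c <= x & sin x = cos c * x.
Proof.
move=> x0; have [] := @MVT_segment R (@sin R) (@cos R) 0 x x0.
- by apply: continuous_subspaceT; exact: continuous_sin.
- by move=> c; rewrite in_itv/= sin0 !subr0 => cx ->; exists c.
Qed.

Lemma norm_sin_le x : `|sin x| <= `|x|.
Proof.
wlog x0 : x / 0 <= x => [pos|].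
  have [/pos//|/ltW x0] := lerP 0 x.
  by have := pos (- x); rewrite oppr_ge0 sinN !normrN => /(_ x0).
have [c _ ->] := sin_mean_value x0.
by rewrite normrM -[leRHS]mul1r ler_wpM2r// cos_max.
Qed.

Lemma cos_ge_quadratic x : 1 - x ^+ 2 / 2 <= cos x.
Proof.
have -> : cos x = 1 - 2 * sin (x / 2) ^+ 2.
  rewrite {1}(splitr x) cosD -!expr2.
  by have := cos2Dsin2 (x / 2) => /(canRL (addrK _)) ->; ring.
have : sin (x / 2) ^+ 2 <= (x / 2) ^+ 2.
  rewrite -[leLHS]real_normK ?num_real// -[leRHS]real_normK ?num_real//.
  by rewrite lerXn2r ?nnegrE// norm_sin_le.
have -> : x ^+ 2 / 2 = 2 * (x / 2) ^+ 2 by field.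
lra.
Qed.

Definition sinc x : R := if x == 0 then 1 else sin x / x.

Lemma sinc0 : sinc 0 = 1. Proof. by rewrite /sinc eqxx. Qed.

Lemma mulr_sinc x : x * sinc x = sin x.
Proof.
rewrite /sinc; case: eqVneq => [->|x0]; first by rewrite mul0r sin0.
by rewrite mulrC divfK.
Qed.

Lemma sinc_pi : sinc pi = 0.
Proof. by rewrite /sinc gt_eqF ?pi_gt0// sinpi mul0r. Qed.

Lemma norm_sinc_le1 x : `|sinc x| <= 1.
Proof.
rewrite /sinc; case: eqVneq => [_|x0]; first by rewrite normr1.
by rewrite normrM normfV ler_pdivrMr ?normr_gt0// mul1r norm_sin_le.
Qed.

Lemma sinc_ge_quadratic x : 1 - x ^+ 2 / 2 <= sinc x.
Proof.
wlog x0 : x / 0 <= x => [pos|].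
  have [/pos//|/ltW x0] := lerP 0 x.
  have := pos (- x); rewrite oppr_ge0 sqrrN /sinc oppr_eq0 sinN invrN mulrNN.
  exact.
have [->|x_neq0] := eqVneq x 0; first by rewrite sinc0 expr0n/= mul0r subr0.
have [c /andP[c0 cx] sinE] := sin_mean_value x0.
rewrite /sinc (negbTE x_neq0) sinE mulfK//.
apply: le_trans (cos_ge_quadratic c); rewrite lerD2l lerN2 ler_pM2r ?invr_gt0//.
by rewrite lerXn2r ?nnegrE.
Qed.

Lemma sinc_cvg1 : sinc y @[y --> (0 : R)] --> (1 : R).
Proof.
apply: (@squeeze_cvgr _ _ _ _ (fun y => 1 - y ^+ 2 / 2) (cst 1)).
- apply: nearW => y; rewrite sinc_ge_quadratic/=.
  by rewrite (le_trans (ler_norm _))// norm_sinc_le1.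
- have : 1 - y ^+ 2 / 2 @[y --> (0 : R)] --> (1 - 0 ^+ 2 / 2 : R).
    apply: cvgB; first exact: cvg_cst.
    by apply: cvgM; [exact: exprn_continuous|exact: cvg_cst].
  by rewrite expr0n/= mul0r subr0.
- exact: cvg_cst.
Qed.

Lemma continuous_sinc : continuous sinc.
Proof.
move=> x; have [->|x0] := eqVneq x 0.
  by rewrite /continuous_at sinc0; exact: sinc_cvg1.
have sincE : {near x, (fun y => sin y / y) =1 sinc}.
  near=> y; rewrite /sinc ifN//; near: y.
  by apply: cvgr_neq0 x0; exact: cvg_id.
rewrite /continuous_at [sinc x]/sinc (negbTE x0).
apply: cvg_trans (near_eq_cvg sincE) _.
by apply: cvgM; [exact: continuous_sin|exact: cvgV].
Unshelve. all: by end_near. Qed.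

Lemma sinc_gt0 x : 0 <= x < pi -> 0 < sinc x.
Proof.
move=> /andP[x0 xpi]; have [->|x_neq0] := eqVneq x 0; first by rewrite sinc0.
have xgt0 : 0 < x by rewrite lt_neqAle eq_sym x_neq0.
by rewrite /sinc (negbTE x_neq0) divr_gt0// sin_gt0_pi// xgt0.
Qed.

Lemma sinc_bounded_below th : 0 <= th < pi ->
  exists2 b : R, 0 < b <= 1 & forall x, 0 <= x <= th -> b <= sinc x.
Proof.
move=> /andP[th0 thpi].
have [c + min_c] := @EVT_min R sinc 0 th th0
  (continuous_subspaceT continuous_sinc).
rewrite in_itv/= => /andP[c0 cth]; exists (sinc c).
  rewrite sinc_gt0 ?c0 ?(le_lt_trans cth)//=.
  by rewrite (le_trans (ler_norm _))// norm_sinc_le1.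
by move=> x xth; apply: min_c; rewrite in_itv.
Qed.

Lemma sin_neq0_at_right x : \forall y \near x^'+, sin y != 0.
Proof.
have [sx|sx] := eqVneq (sin x) 0; last first.
  apply: cvgr_neq0 sx; apply: cvg_at_right_filter; exact: continuous_sin.
have xpi : x < x + pi by rewrite ltrDl pi_gt0.
near=> y; rewrite -(subrK x y) sinD sx mulr0 addr0 mulf_neq0//.
  rewrite gt_eqF// sin_gt0_pi// subr_gt0 ltrBlDl; apply/andP; split.
    by near: y; exact: nbhs_right_gt.
  by near: y; exact: nbhs_right_lt.
by rewrite -normr_eq0 sin0cos1// oner_eq0.
Unshelve. all: by end_near. Qed.

Lemma sinc_neq0_at_right x (c : R) : 0 < c ->
  \forall y \near x^'+, sinc (c * y) != 0.
Proof.
move=> c0; have [e /= e0 sin_neq0] := sin_neq0_at_right (c * x).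
exists (e / c) => /=; first exact: divr_gt0.
move=> y /= xye xy; apply/eqP => sinc_eq0.
suff : sin (c * y) != 0 by rewrite -mulr_sinc sinc_eq0 mulr0 eqxx.
apply: sin_neq0 => /=; last by rewrite ltr_pM2l.
by rewrite /ball/= -mulrBr normrM (gtr0_norm c0) -ltr_pdivlMl// mulrC.
Qed.

End sinc.

Section sinc_product.
Context (R : realType).
Implicit Types (t u : nat -> R) (s : R).

Definition sinc_product t s n : R := \prod_(0 <= k < n) sinc (t k / 2 * s).

Lemma l2_tilde_nonincreasing t m n : l2_tilde t -> (m <= n)%N -> t n <= t m.
Proof. by move=> [/nonincreasing_seqP + _ _]; apply. Qed.

Lemma l2_tilde_shift t n : l2_tilde t -> l2_tilde (fun k => t (n + k)%N).
Proof.
move=> [dt t0 ct]; split=> [k|k|]; [by rewrite addnS|exact: t0|].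
have t20 k : 0 <= t k ^+ 2 by exact: sqr_ge0.
apply: nondecreasing_is_cvgn; first exact: nondecreasing_series.
exists (limn (series (fun k => t k ^+ 2)) - series (fun k => t k ^+ 2) n).
by move=> _ [m _ <-]; exact: sum_tail_le.
Qed.

Lemma sinc_product_bounded_below u s1 : l2_tilde u -> u 0%N / 2 * s1 < pi ->
  exists2 c : R, 0 < c & forall s n, 0 <= s <= s1 -> c <= sinc_product u s n.
Proof.
move=> lu u0pi; have [_ u0 cu] := lu.
have [s1_lt0|s1_ge0] := ltP s1 0.
  by exists 1 => // s n /andP[s0 /le_lt_trans/(_ s1_lt0)]; rewrite ltNge s0.
have [|b b01 sinc_ge] := @sinc_bounded_below R (u 0%N / 2 * s1).
  by rewrite u0pi mulr_ge0// divr_ge0.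
pose a k := (u k / 2 * s1) ^+ 2 / 2.
have a0 k : 0 <= a k by rewrite divr_ge0// sqr_ge0.
have ca : cvgn (series a).
  rewrite (_ : a = (s1 ^+ 2 / 8) *: (fun k => u k ^+ 2)).
    exact: is_cvg_seriesZ.
  by apply/funext => k; rewrite /a fctE /GRing.scale/=; field.
have [c c0 c_le] := prod_bounded_below a0 ca b01.
exists c => // s n /andP[s0 ss1].
have arg_le k : 0 <= u k / 2 * s <= u k / 2 * s1.
  by rewrite mulr_ge0 ?divr_ge0//= ler_wpM2l// divr_ge0.
apply: c_le => k; have /andP[arg0 arg1] := arg_le k.
  apply: sinc_ge; rewrite arg0 (le_trans arg1)// ler_wpM2r// ler_wpM2r//.
  exact: l2_tilde_nonincreasing.
apply: le_trans (sinc_ge_quadratic _); rewrite lerD2l lerN2 ler_wpM2r//.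
by rewrite lerXn2r ?nnegrE// (le_trans arg0).
Qed.

Lemma sinc_productD t s n m : sinc_product t s (n + m) =
  sinc_product t s n * sinc_product (fun k => t (n + k)%N) s m.
Proof.
by rewrite /sinc_product (big_cat_nat (leq0n n) (leq_addr m n))/= big_nat_shift.
Qed.

Lemma sinc_product_cancel t u s n (c z : R) :
  (forall k, (k < n)%N -> t k = u k) ->
  sinc_product t s @ \oo --> z -> sinc_product u s @ \oo --> z ->
  sinc_product t s n != 0 ->
  (forall m, c <= sinc_product (fun k => u (n + k)%N) s m) ->
  c <= `|sinc (t n / 2 * s)|.
Proof.
move=> tu ct cu t_neq0 c_le.
have z_ub : `|z| <= `|sinc_product t s n| * `|sinc (t n / 2 * s)|.
  apply: (ler_cvg_to (cvg_norm ct) (cvg_cst _)).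
  exists n.+1 => // m /= /subnKC <-; rewrite addSnnS sinc_productD normrM.
  rewrite ler_wpM2l// /sinc_product big_nat_recl//= normrM addn0 ler_piMr//.
  by rewrite normr_prod prodr_ile1// => k _; rewrite normr_ge0 norm_sinc_le1.
have z_lb : `|sinc_product t s n| * c <= `|z|.
  apply: (ler_cvg_to (cvg_cst _) (cvg_norm cu)).
  exists n => // m /= /subnKC <-; rewrite sinc_productD normrM.
  rewrite (_ : sinc_product u s n = sinc_product t s n).
    by apply: ler_wpM2l => //; apply: le_trans (ler_norm _).
  by apply: eq_big_nat => k /andP[_ kn]; rewrite tu.
by have := le_trans z_lb z_ub; rewrite ler_pM2l ?normr_gt0.
Qed.

Lemma sinc_product_neq0_at_right t n (s0 : R) :
  (forall k, (k < n)%N -> 0 < t k) ->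
  \forall s \near s0^'+, sinc_product t s n != 0.
Proof.
move=> t_gt0.
have factors_neq0 : \forall s \near s0^'+, forall k : 'I_n,
    sinc (t k / 2 * s) != 0.
  apply: filter_forall => k; apply: sinc_neq0_at_right.
  by rewrite divr_gt0// t_gt0.
apply: filterS factors_neq0 => s s_neq0.
by rewrite /sinc_product big_mkord; apply/prodf_neq0 => k _.
Qed.

Lemma sinc_cvg0_at_right (c : R) : 0 < c ->
  sinc (c / 2 * s) @[s --> (2 * pi / c)^'+] --> (0 : R).
Proof.
move=> c0; have <- : sinc (c / 2 * (2 * pi / c)) = 0.
  by rewrite (_ : _ * _ = pi) ?sinc_pi//; field; rewrite gt_eqF.
apply: cvg_at_right_filter; apply: continuous_comp; last exact: continuous_sinc.
by apply: cvgM; [exact: cvg_cst|exact: cvg_id].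
Qed.

(* Evaluated just to the right of 2 pi / t_n, where the cardinal sine of index n
   almost vanishes and the common factors do not vanish. *)
Lemma sinc_product_lim_le t u (phi : R -> R) n : l2_tilde t -> l2_tilde u ->
  (forall k, (k < n)%N -> t k = u k) ->
  (forall s, sinc_product t s @ \oo --> phi s) ->
  (forall s, sinc_product u s @ \oo --> phi s) ->
  t n <= u n.
Proof.
move=> lt lu tu ct cu; rewrite leNgt; apply/negP => un_lt_tn.
have [_ u0 _] := lu; have tn0 : 0 < t n by exact: le_lt_trans un_lt_tn.
have pi0 : 0 < pi :> R := pi_gt0 R.
pose s0 := 2 * pi / t n; pose s1 := 4 * pi / (t n + u n).
have s0_gt0 : 0 < s0 by rewrite divr_gt0// mulr_gt0.
have tun0 : 0 < t n + u n by rewrite ltr_wpDr.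
have s01 : s0 < s1.
  rewrite /s0 /s1 ltr_pdivrMr// mulrAC ltr_pdivlMr//.
  have : pi * u n < pi * t n by rewrite ltr_pM2l.
  lra.
have uns1 : u (n + 0)%N / 2 * s1 < pi.
  rewrite addn0 /s1 (_ : _ * _ = pi * (2 * u n / (t n + u n))).
    by rewrite gtr_pMr// ltr_pdivrMr//; lra.
  by field; rewrite gt_eqF.
have [c c0 c_le] := sinc_product_bounded_below (l2_tilde_shift n lu) uns1.
near s0^'+ => s.
have s0s : s0 < s by near: s; exact: nbhs_right_gt.
have ss1 : s < s1 by near: s; exact: nbhs_right_lt.
have common_neq0 : sinc_product t s n != 0.
  near: s; apply: sinc_product_neq0_at_right => k kn.
  by rewrite (lt_le_trans tn0)// l2_tilde_nonincreasing// ltnW.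
have : `|sinc (t n / 2 * s)| < c.
  rewrite -[X in `|X|]subr0 distrC; near: s.
  exact: (@cvgr_dist_lt _ _ _ _ _ _ _ (sinc_cvg0_at_right tn0)).
apply/negP; rewrite -leNgt.
apply: (sinc_product_cancel tu (ct s) (cu s) common_neq0) => m.
by apply: c_le; rewrite (ltW (lt_trans s0_gt0 s0s)) ltW.
Unshelve. all: by end_near. Qed.

Lemma sinc_product_lim_inj t u (phi : R -> R) : l2_tilde t -> l2_tilde u ->
  (forall s, sinc_product t s @ \oo --> phi s) ->
  (forall s, sinc_product u s @ \oo --> phi s) -> t = u.
Proof.
move=> lt lu ct cu; apply/funext => n.
elim/ltn_ind: n => n tu; apply/eqP; rewrite eq_le.
by rewrite (sinc_product_lim_le lt lu tu ct cu)
  (sinc_product_lim_le lu lt _ cu ct)// => k /tu.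
Qed.

End sinc_product.

(** * Uniform laws *)

(* [uniform_prob] lives on [measurableTypeR R], whose measurable sets are those
   of [R] but whose display differs; this transports it to [R]. *)
Definition uniform_law (R : realType) (a b : R) (ab : a < b) :
    probability R R :=
  distribution (uniform_prob ab)
    (@mfun_Sub _ _ (measurableTypeR R) R idfun
      (mem_set (@measurable_id _ (measurableTypeR R) setT))).

Lemma uniform_lawE (R : realType) (a b : R) (ab : a < b) (A : set R) :
  uniform_law ab A = uniform_prob ab A.
Proof. by []. Qed.

Section uniform_law.
Context (R : realType).
Implicit Types (a b c e : R).

Lemma uniform_law_ray a b (ab : a < b) (x : R) :
  uniform_law ab `]x, +oo[%classic =
  ((b - Num.max a (Num.min b x)) / (b - a))%:E.
Proof.
have ba0 : 0 < b - a by rewrite subr_gt0.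
rewrite uniform_lawE /uniform_prob integral_uniform_pdf.
rewrite (eq_integral (fun=> (b - a)^-1%:E)) => [|y]; last first.
  by rewrite inE/= => -[_]; rewrite in_itv/= /uniform_pdf => ->.
rewrite integral_cst//=; last exact: measurableI.
rewrite [in RHS]mulrC EFinM; congr (_ * _)%E.
have [xa|ax] := ltP x a.
  rewrite (min_idPr _) ?(ltW (lt_trans xa ab))// (max_idPl (ltW xa)).
  rewrite (_ : _ `&` _ = `[a, b]%classic).
    by rewrite lebesgue_measure_itv/= lte_fin ab.
  apply/seteqP; split=> y /=; rewrite !in_itv/= ?andbT; first by case.
  by move=> /andP[ay yb]; rewrite (lt_le_trans xa ay) ay yb.
have [bx|xb] := leP b x.
  rewrite (max_idPr (ltW ab)) subrr.
  rewrite (_ : _ `&` _ = set0) ?measure0//.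
  apply/seteqP; split=> // y /=; rewrite !in_itv/= andbT => -[xy /andP[_ yb]].
  by move: xy; rewrite ltNge (le_trans yb).
rewrite (max_idPr ax).
rewrite (_ : _ `&` _ = `]x, b]%classic) ?lebesgue_measure_itv/= ?lte_fin ?xb//.
apply/seteqP; split=> y /=; rewrite !in_itv/= ?andbT.
  by move=> [-> /andP[_ ->]].
by move=> /andP[xy ->]; rewrite xy (le_trans ax (ltW xy)).
Qed.

Lemma uniform_law_itv a b (ab : a < b) :
  {ae uniform_law ab, forall x : R, a <= x < b}.
Proof.
exists (~` `[a, b[%classic); split; first exact: measurableC.
- rewrite uniform_lawE /uniform_prob integral_uniform_pdf.
  rewrite (_ : _ `&` _ = [set b]) ?integral_set1//.
  apply/seteqP; split=> x /=; rewrite !in_itv/=.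
    move=> [/negP + /andP[ax xb]]; rewrite ax/= -leNgt => bx.
    by apply/eqP; rewrite eq_le xb.
  by move=> ->; rewrite ltxx (ltW ab) lexx andbF.
- by move=> x /= /negP; rewrite in_itv/= => /negP.
Qed.

Lemma uniform_law_affine a b c e (ab : a < b) (ab' : c * a + e < c * b + e)
    (A : set R) : 0 < c -> measurable A ->
  uniform_law ab [set x | A (c * x + e)] = uniform_law ab' A.
Proof.
move=> c0 mA.
pose F : {mfun R >-> R} := mfun_Sub (mem_set (@measurable_affine R c e)).
apply: (@measure_unique_rays R (distribution (uniform_law ab) F)) => //.
  by rewrite (le_lt_trans (probability_le1 _ _)) ?ltry.
move=> x; rewrite [RHS](uniform_law_ray ab' x) /distribution/= /pushforward.
rewrite (_ : F @^-1` _ = `](x - e) / c, +oo[%classic); last first.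
  apply/seteqP; split=> y /=;
    by rewrite !in_itv/= !andbT ltr_pdivrMr// ltrBlDr mulrC.
rewrite [LHS](uniform_law_ray ab); congr (_%:E).
have [z -> {x}] : exists z, x = c * z + e.
  by exists ((x - e) / c); rewrite mulrC divfK ?subrK// gt_eqF.
rewrite addrK [c * z]mulrC mulfK ?gt_eqF// [z * c]mulrC.
have affine_le y y' : (c * y + e <= c * y' + e) = (y <= y').
  by rewrite lerD2r ler_pM2l.
have minE : Num.min (c * b + e) (c * z + e) = c * Num.min b z + e.
  by rewrite /Num.min !ltNge affine_le; case: ifP.
have maxE y y' : Num.max (c * y + e) (c * y' + e) = c * Num.max y y' + e.
  by rewrite /Num.max !ltNge affine_le; case: ifP.
rewrite minE maxE; move: (Num.max _ _) => y; field.
by rewrite !gt_eqF ?subr_gt0.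
Qed.

Lemma integral_uniform_law a b (ab : a < b) (f F : R -> R) :
  continuous f -> (forall x : R, is_derive x 1 F (f x)) ->
  (\int[uniform_law ab]_x (f x)%:E = ((F b - F a) / (b - a))%:E)%E.
Proof.
move=> cf dF.
have ge0E (g : R -> \bar R) : measurable_fun setT g -> (forall x, 0 <= g x)%E ->
    (\int[uniform_law ab]_x g x =
     (b - a)^-1%:E * \int[lebesgue_measure]_(x in `[a, b]) g x)%E.
  move=> mg g0; rewrite /uniform_law ge0_integral_distribution//=.
  exact: integral_uniform.
have mf : measurable_fun setT (EFin \o f).
  by apply/measurable_EFinP; exact: continuous_measurable_fun.
have if_ab : lebesgue_measure.-integrable `[a, b] (EFin \o f).
  apply: continuous_compact_integrable; first exact: segment_compact.
  exact: continuous_subspaceT.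
have F_cont : continuous F.
  move=> x; apply: differentiable_continuous; apply/derivable1_diffP.
  exact: ex_derive.
have FTC : (\int[lebesgue_measure]_(x in `[a, b]) (f x)%:E = (F b - F a)%:E)%E.
  rewrite (@continuous_FTC2 _ f F)//.
  - exact: continuous_subspaceT.
  - split=> [x _||]; first exact: ex_derive.
    + by apply: cvg_at_right_filter; exact: F_cont.
    + by apply: cvg_at_left_filter; exact: F_cont.
  - by move=> x _; rewrite derive1E derive_val.
have -> : ((F b - F a) / (b - a))%:E =
    ((b - a)^-1%:E * \int[lebesgue_measure]_(x in `[a, b]) (f x)%:E)%E.
  by rewrite FTC -EFinM mulrC.
rewrite integralE [X in _ = (_ * X)%E]integralE muleBr//; last first.
  rewrite fin_num_adde_defr//; exact: integrable_pos_fin_num if_ab.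
by rewrite !ge0E//; [exact: measurable_funeneg|exact: measurable_funepos].
Qed.

End uniform_law.

Section uniform_on.
Context (R : realType) (d : measure_display) (T : measurableType d).
Context (P : probability T R).
Implicit Types (X Y : {RV P >-> R}) (a b c e s t z : R).

Lemma uniform_on_law a b (ab : a < b) X : uniform_on a b X ->
  law P X = law (uniform_law ab) idfun.
Proof. by move=> [_ Xab _]; apply/law_eqP => A mA; exact: Xab. Qed.

Lemma uniform_on_ae_cst a X : uniform_on a a X -> {ae P, forall w, X w = a}.
Proof.
move=> [_ _ /(_ erefl) Xa]; exists (X @^-1` (~` [set a])); split => //.
- by apply: measurable_preimage => //; exact: measurableC.
- rewrite [LHS]Xa; last exact: measurableC.
  by rewrite diracE memNset//= => /(_ erefl).
Qed.

Lemma uniform_on_integral a b X (f F : R -> R) : a < b -> uniform_on a b X ->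
  continuous f -> (forall x : R, is_derive x 1 F (f x)) ->
  (\int[P]_w (f (X w))%:E = ((F b - F a) / (b - a))%:E)%E.
Proof.
move=> ab uX cf dF; rewrite -(integral_uniform_law ab cf dF).
have mf : measurable_fun setT (EFin \o f).
  by apply/measurable_EFinP; exact: continuous_measurable_fun.
pose idRV : {RV uniform_law ab >-> R} :=
  mfun_Sub (mem_set (@measurable_id _ R setT)).
exact: (integral_law (Y := idRV) mf (uniform_on_law ab uX)).
Qed.

Lemma uniform_on_expectation_cst a X (f : R -> R) : uniform_on a a X ->
  measurable_fun setT f -> ('E_P[f \o X] = (f a)%:E)%E.
Proof.
move=> uX mf; rewrite -(expectation_cst P (f a)) !unlock.
have mfX : measurable_fun setT (f \o X) by exact: measurableT_comp.
apply: ae_eq_integral => //; try exact/measurable_EFinP.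
by apply: filterS (uniform_on_ae_cst uX) => w Xa _ /=; rewrite Xa.
Qed.

Lemma uniform_on_second_moment a b X : uniform_on a b X ->
  ('E_P[(fun w => X w ^+ 2)%R] = ((a ^+ 2 + a * b + b ^+ 2) / 3)%:E)%E.
Proof.
move=> uX; have [+ _ _] := uX; rewrite le_eqVlt => /predU1P[ab|ab].
  move: uX; rewrite -ab => uX.
  rewrite (uniform_on_expectation_cst uX (exprn_measurable 2)).
  by congr EFin; field.
pose f x : R := x ^+ 2; pose F : R -> R := 3^-1 *: (id ^+ 3 : R -> R).
rewrite unlock [LHS](@uniform_on_integral a b X f F ab uX).
- congr EFin; rewrite /F !fctE /GRing.scale/=; field.
  by rewrite subr_eq0 gt_eqF.
- exact: exprn_continuous.
- by move=> x; apply: is_derive_eq; rewrite /GRing.scale/= mulr1 mulKf.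
Qed.

Lemma uniform_on_Lfun2 a b X : uniform_on a b X -> (X : T -> R) \in Lfun P 2%:E.
Proof.
move=> uX; apply: Lfun2P => //.
by have := uniform_on_second_moment uX; rewrite unlock => ->; exact: ltry.
Qed.

Lemma uniform_on_expectation a b X : uniform_on a b X ->
  ('E_P[X] = ((a + b) / 2)%:E)%E.
Proof.
move=> uX; have [+ _ _] := uX; rewrite le_eqVlt => /predU1P[ab|ab].
  move: uX; rewrite -ab => uX.
  rewrite [LHS](uniform_on_expectation_cst uX (@measurable_id _ _ _)).
  by congr EFin; field.
pose F : R -> R := 2^-1 *: (id ^+ 2 : R -> R).
rewrite unlock [LHS](@uniform_on_integral a b X id F ab uX).
- congr EFin; rewrite /F !fctE /GRing.scale/=; field.
  by rewrite subr_eq0 gt_eqF.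
- by move=> x; exact: cvg_id.
- by move=> x; apply: is_derive_eq; rewrite /GRing.scale/= mulr1 mulKf.
Qed.

Lemma uniform_on_variance a b X : uniform_on a b X ->
  ('V_P[X] = ((b - a) ^+ 2 / 12)%:E)%E.
Proof.
move=> uX; rewrite varianceE ?(uniform_on_Lfun2 uX)//.
rewrite [X in (X - _)%E](uniform_on_second_moment uX).
rewrite (uniform_on_expectation uX).
by rewrite -EFin_expe -EFinB; congr EFin; field.
Qed.

Lemma centered_uniform_cos t s z X : uniform_on (- (t / 2)) (t / 2) X ->
  ('E_P[(fun w => cos (s * X w + z))%R] = (cos z * sinc (t / 2 * s))%:E)%E.
Proof.
move=> uX; have mcos : measurable_fun setT (fun x => cos (s * x + z)).
  apply: (measurableT_comp (continuous_measurable_fun (@continuous_cos R))).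
  exact: measurable_affine.
have [s0|s0] := eqVneq s 0.
  rewrite s0 mulr0 sinc0 mulr1.
  under [X in expectation _ X]eq_fun do rewrite mul0r add0r.
  exact: expectation_cst.
have [+ _ _] := uX; rewrite le_eqVlt => /predU1P[t0|t0].
  have {}t0 : t = 0 by lra.
  move: uX; rewrite t0 mul0r oppr0 => uX.
  rewrite [LHS](uniform_on_expectation_cst uX mcos).
  by rewrite mulr0 add0r mul0r sinc0 mulr1.
pose f x : R := cos (s * x + z).
pose F : R -> R := s^-1 *: (fun x => sin (s * x + z)).
rewrite unlock [LHS](@uniform_on_integral _ _ X f F t0 uX).
- congr EFin; rewrite /F !fctE /GRing.scale/=.
  have -> : s * (- (t / 2)) + z = z - t / 2 * s by ring.
  have -> : s * (t / 2) + z = z + t / 2 * s by ring.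
  rewrite sinB sinD -!(mulr_sinc (t / 2 * s)).
  by field; apply/andP; split=> //; apply/eqP; lra.
- move=> x; apply: continuous_comp; last exact: continuous_cos.
  exact: continuous_affine.
- move=> x; have affine_derive : is_derive x 1 (fun x : R => s * x + z) s.
    have -> : (fun x => s * x + z) = s *: (id : R -> R) + cst z by [].
    by apply: is_derive_eq; rewrite addr0 /GRing.scale/= mulr1.
  have sin_derive := is_derive1_comp (is_derive_sin _) affine_derive.
  apply: (is_derive_eq (is_deriveZ s^-1 sin_derive)).
  by rewrite /GRing.scale/= mulrC mulfK.
Qed.

Lemma distribution_ae_cst c X : {ae P, forall w, X w = c} ->
  forall A, measurable A -> distribution P X A = \d_c A.
Proof.
move=> Xc A mA.
have mcst : measurable_fun setT (cst c : T -> R) by exact: measurable_cst.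
have /law_eqP X_law := law_ae_eq (measurable_funPT X) mcst Xc.
rewrite [LHS]X_law// preimage_cst diracE; case: ifP => _; last exact: measure0.
exact: probability_setT.
Qed.

Lemma uniform_on_affine a b c e X Y : 0 <= c ->
  (forall w, Y w = c * X w + e) -> uniform_on a b X ->
  uniform_on (c * a + e) (c * b + e) Y.
Proof.
move=> c0 YX uX; have [ab Xab _] := uX; split=> [|ab' A mA|ab_eq].
- by rewrite lerD2r ler_wpM2l.
- have cgt0 : 0 < c.
    rewrite lt_neqAle c0 andbT; apply: contraTneq ab' => <-.
    by rewrite !mul0r ltxx.
  have {}ab : a < b by move: ab'; rewrite ltrD2r ltr_pM2l.
  rewrite -[RHS](uniform_law_affine ab ab' cgt0 mA) -[RHS]Xab; last first.
    rewrite -[X in measurable X]/((fun x => c * x + e) @^-1` A).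
    by apply: measurable_preimage => //; exact: measurable_affine.
  by congr (P _); apply/seteqP; split => w /=; rewrite YX.
- apply: distribution_ae_cst; have [a_eq|a_neq] := eqVneq a b.
    rewrite -a_eq in uX; apply: filterS (uniform_on_ae_cst uX) => w Xa.
    by rewrite YX Xa.
  apply: aeW => w; rewrite YX (_ : c = 0) ?mul0r//.
  have : c * (a - b) == 0 by rewrite mulrBr subr_eq0; apply/eqP/(addIr e).
  by rewrite mulf_eq0 subr_eq0 (negbTE a_neq) orbF => /eqP.
Qed.

End uniform_on.

Lemma uniform_on_law_eq (R : realType) (d d' : measure_display)
    (T : measurableType d) (P : probability T R)
    (T' : measurableType d') (Q : probability T' R)
    (X : {RV P >-> R}) (Y : {RV Q >-> R}) (a b : R) :
  uniform_on a b X -> uniform_on a b Y -> law P X = law Q Y.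
Proof.
move=> uX uY; have [+ _ Xa] := uX; rewrite le_eqVlt => /predU1P[ab|ab].
  by have [_ _ Ya] := uY; apply/law_eqP => A mA; rewrite [LHS]Xa// [RHS]Ya.
by rewrite (uniform_on_law ab uX) (uniform_on_law ab uY).
Qed.

(** * A sequence of independent uniform variables *)

Lemma measurable_iter (d : measure_display) (T : measurableType d)
    (f : T -> T) n : measurable_fun setT f -> measurable_fun setT (iter n f).
Proof.
move=> mf; elim: n => [|n IH]; first exact: measurable_id.
exact: measurableT_comp.
Qed.

Section iterated_splitting.
Context (R : realType) (d : measure_display) (T : measurableType d).
Context (P : probability T R) (e : {RV P >-> R}) (o : {mfun T >-> T}).
Hypothesis o_preserves : forall B, measurable B -> P (o @^-1` B) = P B.
Hypothesis e_o : independent_RV P e o.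

Let measurable_splitting k : measurable_fun setT (e \o iter k o).
Proof. by apply: measurableT_comp => //; exact: measurable_iter. Qed.

Definition splitting k : {RV P >-> R} :=
  mfun_Sub (mem_set (measurable_splitting k)).

Let splittingS k A : splitting k.+1 @^-1` A = o @^-1` (splitting k @^-1` A).
Proof. by apply/seteqP; split=> w; rewrite /preimage/= -iterSr. Qed.

Lemma splitting_law k : law P (splitting k) = law P e.
Proof.
apply/law_eqP => A mA; elim: k => [//|k IH].
by rewrite splittingS o_preserves//; exact: measurable_preimage.
Qed.

Lemma splitting_mutually_independent : mutually_independent splitting.
Proof.
apply/mutually_independentP => n; elim: n => [|n IH] A mA AT.
  rewrite big_geq// (_ : \bigcap_k _ = setT); first exact: probability_setT.
  by apply/seteqP; split=> // w _ k _; rewrite AT// preimage_setT.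
have -> : \bigcap_k (splitting k @^-1` A k) =
    e @^-1` A 0%N `&` o @^-1` (\bigcap_k (splitting k @^-1` A k.+1)).
  apply/seteqP; split=> w => [h|[h0 h] [|k] _].
  - by split=> [|k _]; [exact: (h 0%N)|have := h k.+1 I; rewrite splittingS].
  - exact: h0.
  - by rewrite splittingS; exact: (h k I).
have mI : measurable (\bigcap_k (splitting k @^-1` A k.+1)).
  by apply: bigcapT_measurable => k; exact: measurable_preimage.
rewrite e_o// o_preserves// (IH (fun k => A k.+1))//; last first.
  by move=> k nk; rewrite AT.
rewrite big_nat_recl//=.
congr (_ * _)%E; apply: eq_bigr => k _.
by rewrite splittingS o_preserves//; exact: measurable_preimage.
Qed.

End iterated_splitting.

Section binary_digits.
Context (R : realType).
Implicit Types (x y z : R) (i : bool).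

Let U : probability R R := uniform_law (@ltr01 R).

Definition half_map i x : R := 2^-1 * x + i%:R / 2.

Lemma half_map_lt i x z : (x < half_map i z) = (2 * x - i%:R < z).
Proof. by apply/idP/idP; rewrite /half_map; lra. Qed.

Lemma measurable_half_map i : measurable_fun setT (half_map i).
Proof. exact: measurable_affine. Qed.

Definition unit_ray x : R := 1 - Num.max 0 (Num.min 1 x).

Lemma uniform_law01_ray x : U `]x, +oo[%classic = (unit_ray x)%:E.
Proof. by rewrite [LHS]uniform_law_ray subr0 divr1. Qed.

Lemma unit_ray_lt0 x : x < 0 -> unit_ray x = 1.
Proof.
rewrite /unit_ray.
by do ?[case: (leP 1 _) => ?]; do ?[case: (leP 0 _) => ?]; lra.
Qed.

Lemma unit_ray_ge1 x : 1 <= x -> unit_ray x = 0.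
Proof.
rewrite /unit_ray.
by do ?[case: (leP 1 _) => ?]; do ?[case: (leP 0 _) => ?]; lra.
Qed.

Lemma unit_ray01 x : 0 <= unit_ray x <= 1.
Proof.
by rewrite /unit_ray subr_ge0 gerBl ge_max ler01 ge_min lexx le_max lexx.
Qed.

Lemma unit_ray_half x :
  unit_ray x = (unit_ray (2 * x) + unit_ray (2 * x - 1)) / 2.
Proof.
rewrite /unit_ray.
by do ?[case: (leP 1 _) => ?]; do ?[case: (leP 0 _) => ?]; lra.
Qed.

Lemma unit_ray_unique (f : R -> R) : (forall x, 0 <= f x <= 1) ->
  (forall x, f x = (f (2 * x) + f (2 * x - 1)) / 2) ->
  (forall x, x < 0 -> f x = 1) -> (forall x, 1 <= x -> f x = 0) ->
  f = unit_ray.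
Proof.
move=> f01 fhalf f1 f0; apply/funext => x.
apply/eqP; rewrite -subr_eq0 -normr_eq0; apply/eqP; move: x.
apply: (@halving_eq0 _ _ (fun x => `|f x - unit_ray x|)) => x.
  rewrite normr_ge0/= ler_norml.
  by have /andP[? ?] := f01 x; have /andP[? ?] := unit_ray01 x; lra.
rewrite fhalf unit_ray_half -mulrBl normrM (@ger0_norm _ 2^-1)//.
have [x1|x1] := leP 1 (2 * x).
  exists (2 * x - 1).
  by rewrite (f0 (2 * x))// (unit_ray_ge1 (x := 2 * x))// !add0r.
exists (2 * x).
rewrite (f1 (2 * x - 1)) ?(unit_ray_lt0 (x := 2 * x - 1)) ?subr_lt0//.
by rewrite opprD addrACA subrr addr0.
Qed.

Lemma uniform_law01_half (A : set R) : measurable A ->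
  U A = (2^-1%:E * U (half_map false @^-1` A) +
         2^-1%:E * U (half_map true @^-1` A))%E.
Proof.
have half0 : 0 <= (2^-1 : R) by rewrite invr_ge0.
pose F i : {mfun R >-> R} := mfun_Sub (mem_set (measurable_half_map i)).
pose m i := mscale (NngNum half0) (distribution U (F i)).
rewrite -[RHS](measure_addE (m false) (m true)).
move: A; apply: (@measure_unique_rays R U (measure_add (m false) (m true))).
  by rewrite (le_lt_trans (probability_le1 U measurableT))// ltry.
move=> x; have m_ray i :
    m i `]x, +oo[%classic = (2^-1 * unit_ray (2 * x - i%:R))%:E.
  rewrite EFinM -uniform_law01_ray; congr (_ * U _)%E.
  by apply/seteqP; split=> z /=; rewrite !in_itv/= !andbT half_map_lt.
rewrite [LHS]uniform_law01_ray [RHS]measure_addE.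
rewrite [X in (X + _)%E](m_ray false) [X in (_ + X)%E](m_ray true) -EFinD.
by rewrite unit_ray_half subr0; congr EFin; field.
Qed.

Lemma uniform_law01_split (A : set R) (B : bool -> set R) :
  measurable A -> (forall i, measurable (B i)) ->
  (forall i z, 0 <= z < 1 -> A (half_map i z) <-> B i z) ->
  U A = (2^-1%:E * U (B false) + 2^-1%:E * U (B true))%E.
Proof.
move=> mA mB AB; rewrite uniform_law01_half//.
have UE i : U (half_map i @^-1` A) = U (B i).
  apply: measure_ae_eq => //.
    by apply: measurable_preimage => //; exact: measurable_half_map.
  by apply: filterS (uniform_law_itv (@ltr01 R)) => z; exact: AB.
by rewrite !UE.
Qed.

Definition first_bit x : R := (2^-1 <= x)%R%:R.

Definition doubling x : R := 2 * x - first_bit x.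

Lemma first_bit01 x : 0 <= first_bit x <= 1.
Proof. by rewrite /first_bit ler0n lern1 leq_b1. Qed.

Lemma measurable_first_bit : measurable_fun setT first_bit.
Proof.
rewrite (_ : first_bit = \1_(`[2^-1, +oo[%classic)).
  exact: measurable_indic.
by apply/funext => x; rewrite indicE /first_bit mem_setE in_itv/= andbT.
Qed.

Lemma measurable_doubling : measurable_fun setT doubling.
Proof.
by apply: measurable_funB; [exact: measurable_funM|exact: measurable_first_bit].
Qed.

Lemma first_bit_half i x : 0 <= x < 1 -> first_bit (half_map i x) = i%:R.
Proof.
move=> /andP[x0 x1]; rewrite /first_bit; congr (nat_of_bool _)%:R.
by apply/idP/idP; rewrite /half_map; case: i => //=; lra.
Qed.

Lemma doubling_half i x : 0 <= x < 1 -> doubling (half_map i x) = x.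
Proof. by move=> x01; rewrite /doubling first_bit_half// /half_map; field. Qed.

Definition even_bits_partial n x : R :=
  \sum_(0 <= k < n) 2^-1 ^+ k.+1 * first_bit (iter k.*2 doubling x).

Definition even_bits x : R := limn (even_bits_partial^~ x).

Definition odd_bits x : R := even_bits (doubling x).

Lemma even_bits_partialS n x :
  even_bits_partial n x <= even_bits_partial n.+1 x <=
  even_bits_partial n x + 2^-1 ^+ n.+1.
Proof.
rewrite /even_bits_partial big_nat_recr//= lerDl lerD2l.
have /andP[b0 b1] := first_bit01 (iter n.*2 doubling x).
by rewrite mulr_ge0 ?ler_piMr ?exprn_ge0 ?invr_ge0.
Qed.

Lemma even_bits_partial01 n x : 0 <= even_bits_partial n x <= 1.
Proof.
suff : 0 <= even_bits_partial n x <= 1 - 2^-1 ^+ n.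
  by move=> /andP[-> /le_trans]; apply; rewrite gerBl exprn_ge0 ?invr_ge0.
elim: n => [|n /andP[IH0 IH1]].
  by rewrite /even_bits_partial big_geq// expr0 subrr lexx.
have /andP[b0 b1] := even_bits_partialS n x.
rewrite (le_trans IH0 b0) (le_trans b1)//.
by rewrite (le_trans (lerD IH1 (lexx _)))// exprS; lra.
Qed.

Lemma even_bits_cvg x : even_bits_partial^~ x @ \oo --> even_bits x.
Proof.
apply: nondecreasing_is_cvgn.
  by apply/nondecreasing_seqP => n; case/andP: (even_bits_partialS n x).
by exists 1 => _ [n _ <-]; case/andP: (even_bits_partial01 n x).
Qed.

Lemma even_bits01 x : 0 <= even_bits x <= 1.
Proof.
have cx : cvgn (even_bits_partial^~ x).
  by apply/cvg_ex; eexists; exact: even_bits_cvg.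
by apply/andP; split; [apply: limr_ge => //|apply: limr_le => //];
  apply: nearW => n; case/andP: (even_bits_partial01 n x).
Qed.

Lemma measurable_even_bits : measurable_fun setT even_bits.
Proof.
apply: (@measurable_fun_cvg _ _ _ _ even_bits_partial) => [n|x _].
  apply: measurable_sum => k; apply: measurable_funM => //.
  apply: measurableT_comp; first exact: measurable_first_bit.
  by apply: measurable_iter; exact: measurable_doubling.
exact: even_bits_cvg.
Qed.

Lemma measurable_odd_bits : measurable_fun setT odd_bits.
Proof.
apply: measurableT_comp; first exact: measurable_even_bits.
exact: measurable_doubling.
Qed.

HB.instance Definition _ :=
  isMeasurableFun.Build _ _ _ _ even_bits measurable_even_bits.

HB.instance Definition _ :=
  isMeasurableFun.Build _ _ _ _ odd_bits measurable_odd_bits.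

Lemma even_bits_rec x : even_bits x = (first_bit x + odd_bits (doubling x)) / 2.
Proof.
have even_shift : even_bits_partial n.+1 x @[n --> \oo] --> even_bits x.
  by rewrite (cvg_shiftS (even_bits_partial^~ x)); exact: even_bits_cvg.
apply/esym; apply: cvg_unique even_shift => //.
rewrite (_ : (fun n => _) = fun n =>
    (first_bit x + even_bits_partial n (doubling (doubling x))) / 2).
  apply: cvgM; last exact: cvg_cst.
  by apply: cvgD; [exact: cvg_cst|exact: even_bits_cvg].
apply/funext => n; rewrite /even_bits_partial big_nat_recl//= expr1.
rewrite mulrDl mulrC; congr (_ + _); rewrite mulr_suml.
by apply: eq_bigr => k _; rewrite (exprS _ k.+1) -!iterSr -mulrA mulrC.
Qed.

Lemma even_bits_half i x : 0 <= x < 1 ->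
  even_bits (half_map i x) = half_map i (odd_bits x).
Proof.
move=> x01; rewrite even_bits_rec first_bit_half// doubling_half//.
by rewrite /half_map; field.
Qed.

Lemma odd_bits_half i x : 0 <= x < 1 -> odd_bits (half_map i x) = even_bits x.
Proof. by move=> x01; rewrite /odd_bits doubling_half. Qed.

Lemma uniform_law01_doubling A : measurable A -> U (doubling @^-1` A) = U A.
Proof.
move=> mA; rewrite (@uniform_law01_split _ (fun=> A))//.
- by rewrite -ge0_muleDl ?lee_fin ?invr_ge0// -EFinD -[2^-1]mul1r -splitr mul1e.
- by apply: measurable_preimage => //; exact: measurable_doubling.
- by move=> i z z01; rewrite /preimage/= doubling_half.
Qed.

Let measurable_bits_event x y :
  measurable (even_bits @^-1` `]x, +oo[ `&` odd_bits @^-1` `]y, +oo[).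
Proof. by apply: measurableI; exact: measurable_preimage. Qed.

Definition bits_ray x y : R :=
  fine (U (even_bits @^-1` `]x, +oo[ `&` odd_bits @^-1` `]y, +oo[)).

Lemma bits_rayE x y :
  U (even_bits @^-1` `]x, +oo[ `&` odd_bits @^-1` `]y, +oo[) =
  (bits_ray x y)%:E.
Proof. by rewrite fineK ?fin_num_measure. Qed.

Lemma bits_ray01 x y : 0 <= bits_ray x y <= 1.
Proof.
by rewrite -!lee_fin -bits_rayE measure_ge0 probability_le1.
Qed.

(* Halving the point swaps the two digit sequences and shifts one of them. *)
Lemma bits_ray_half x y :
  bits_ray x y = (bits_ray y (2 * x) + bits_ray y (2 * x - 1)) / 2.
Proof.
apply: EFin_inj; rewrite -bits_rayE (@uniform_law01_split _
  (fun i => even_bits @^-1` `]y, +oo[ `&` odd_bits @^-1` `]2 * x - i%:R, +oo[)).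
- by rewrite !bits_rayE -!EFinM -EFinD subr0; congr EFin; field.
- exact: measurable_bits_event.
- by move=> i; apply: measurableI; exact: measurable_preimage.
- move=> i z z01; rewrite /preimage/= !in_itv/= !andbT.
  by rewrite even_bits_half// odd_bits_half// half_map_lt; split=> -[].
Qed.

Lemma bits_ray_ge1l x y : 1 <= x -> bits_ray x y = 0.
Proof.
move=> x1; rewrite /bits_ray (_ : _ `&` _ = set0) ?measure0//.
apply/seteqP; split=> // z []; rewrite /preimage/= in_itv/= andbT ltNge.
by have /andP[_ /le_trans ->] := even_bits01 z.
Qed.

Lemma bits_ray_ge1r x y : 1 <= y -> bits_ray x y = 0.
Proof.
move=> y1; rewrite /bits_ray (_ : _ `&` _ = set0) ?measure0//.
apply/seteqP; split=> // z []; rewrite /preimage/= !in_itv/= !andbT => _.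
by rewrite ltNge; have /andP[_ /le_trans ->] := even_bits01 (doubling z).
Qed.

Lemma bits_ray_lt0r x y : y < 0 ->
  (bits_ray x y)%:E = U (even_bits @^-1` `]x, +oo[).
Proof.
move=> y0; rewrite -bits_rayE (_ : odd_bits @^-1` _ = setT) ?setIT//.
apply/seteqP; split=> // z _; rewrite /preimage/= in_itv/= andbT.
by apply: (lt_le_trans y0); case/andP: (even_bits01 (doubling z)).
Qed.

Lemma bits_ray_lt0l x y : x < 0 ->
  (bits_ray x y)%:E = U (odd_bits @^-1` `]y, +oo[).
Proof.
move=> x0; rewrite -bits_rayE (_ : even_bits @^-1` _ = setT) ?setTI//.
apply/seteqP; split=> // z _; rewrite /preimage/= in_itv/= andbT.
by apply: (lt_le_trans x0); case/andP: (even_bits01 z).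
Qed.

Lemma uniform_law01_even_bits A : measurable A -> U (even_bits @^-1` A) = U A.
Proof.
have N10 : (-1 : R) < 0 by rewrite ltrN10.
move: A; apply: (@measure_unique_rays R (distribution U even_bits) U) => [|x].
  by rewrite (le_lt_trans (probability_le1 _ measurableT))// ltry.
rewrite [RHS]uniform_law01_ray -(@unit_ray_unique (bits_ray^~ (-1))).
- by rewrite (bits_ray_lt0r x N10).
- by move=> y; exact: bits_ray01.
- have swap y : bits_ray (-1) y = bits_ray y (-1).
    apply: EFin_inj; rewrite (bits_ray_lt0l y N10) (bits_ray_lt0r y N10).
    by apply: uniform_law01_doubling; exact: measurable_preimage.
  by move=> y; rewrite bits_ray_half !swap.
- move=> y y0; apply: EFin_inj; rewrite bits_ray_lt0l//.
  rewrite (_ : _ @^-1` _ = setT) ?probability_setT//.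
  apply/seteqP; split=> // z _; rewrite /preimage/= in_itv/= andbT.
  by apply: (lt_le_trans N10); case/andP: (even_bits01 (doubling z)).
- by move=> y; exact: bits_ray_ge1l.
Qed.

Lemma uniform_law01_odd_bits A : measurable A -> U (odd_bits @^-1` A) = U A.
Proof.
move=> mA; apply: etrans (uniform_law01_even_bits mA).
exact: (uniform_law01_doubling (measurable_preimage measurable_even_bits mA)).
Qed.

Lemma bits_ray_unit_ray x y : bits_ray x y = unit_ray x * unit_ray y.
Proof.
pose u p := `|bits_ray p.1 p.2 - unit_ray p.1 * unit_ray p.2|.
suff u0 : u (x, y) = 0 by apply/eqP; rewrite -subr_eq0 -normr_eq0 -u0.
move: (x, y); apply: halving_eq0 => -[{}x {}y]; rewrite /u/=.
  rewrite normr_ge0/= ler_norml.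
  have /andP[? ?] := bits_ray01 x y; have /andP[? ?] := unit_ray01 x.
  by have /andP[? ?] := unit_ray01 y; apply/andP; split; nra.
rewrite bits_ray_half unit_ray_half; have [x1|x1] := leP 1 (2 * x).
  exists (y, 2 * x - 1); rewrite bits_ray_ge1r// unit_ray_ge1// !add0r/=.
  by rewrite mulrAC -mulrBl (mulrC (unit_ray _)) normrM (@ger0_norm _ 2^-1).
exists (y, 2 * x); rewrite (unit_ray_lt0 (_ : 2 * x - 1 < 0)); last by lra.
have -> : bits_ray y (2 * x - 1) = unit_ray y.
  apply: EFin_inj; rewrite bits_ray_lt0r; last by lra.
  by rewrite uniform_law01_even_bits// uniform_law01_ray.
rewrite (_ : _ - _ =
  (bits_ray y (2 * x) - unit_ray y * unit_ray (2 * x)) / 2); last by field.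
by rewrite normrM (@ger0_norm _ 2^-1).
Qed.

Lemma independent_even_odd_bits : independent_RV U even_bits odd_bits.
Proof.
apply: independent_RV_rays => x y.
rewrite uniform_law01_even_bits// uniform_law01_odd_bits// !uniform_law01_ray.
by rewrite bits_rayE bits_ray_unit_ray.
Qed.

End binary_digits.

Lemma iid_uniform_exists (R : realType) :
  exists X : nat -> {RV (uniform_law (@ltr01 R)) >-> R},
    mutually_independent X /\ forall k, uniform_on 0 1 (X k).
Proof.
have e_o := @independent_even_odd_bits R.
exists (splitting (@even_bits R) (@odd_bits R)); split.
  apply: splitting_mutually_independent => //.
  exact: (@uniform_law01_odd_bits R).
move=> k; split=> [|ab A mA|/eqP]; [exact: ler01| |by rewrite eq_sym oner_eq0].
have law_k := splitting_law (@even_bits R) (@uniform_law01_odd_bits R) k.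
rewrite -uniform_lawE -(uniform_law01_even_bits mA).
by move/law_eqP: law_k; exact.
Qed.

(** * Sums of independent uniform variables *)

Lemma uniform_sum_law_eq (R : realType) (d d' : measure_display)
    (T : measurableType d) (P : probability T R)
    (T' : measurableType d') (Q : probability T' R)
    (S : {RV P >-> R}) (S' : {RV Q >-> R}) (a b : nat -> R) :
  is_uniform_sum a b S -> is_uniform_sum a b S' -> law P S = law Q S'.
Proof.
move=> [X [iX uX cX]] [Y [iY uY cY]].
apply: (law_eq_cvg (X_ := partial_sum X) (Y_ := partial_sum Y)) => // n.
by apply: law_partial_sum => // k; exact: uniform_on_law_eq (uX k) (uY k).
Qed.

Section uniform_sum.
Context (R : realType) (d : measure_display) (T : measurableType d).
Context (P : probability T R).
Implicit Types (X : nat -> {RV P >-> R}) (S : {RV P >-> R}).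
Implicit Types (a b l m t : nat -> R) (c e s z : R).

Lemma uniform_sum_affine S a b m c e :
  0 <= c -> series m @ \oo --> e -> is_uniform_sum a b S ->
  is_uniform_sum (fun k => c * a k + m k) (fun k => c * b k + m k)
    (affine_RV c e S).
Proof.
move=> c0 me [X [iX uX cX]]; exists (fun k => affine_RV c (m k) (X k)); split.
- apply: (mutually_independent_comp (g := fun k x => c * x + m k)) iX => //.
  by move=> k; exact: measurable_affine.
- by move=> k; apply: uniform_on_affine (uX k).
- apply: filterS cX => w cw.
  rewrite (_ : (fun n => _) = fun n => c * partial_sum X n w + series m n).
    by apply: cvgD => //; apply: cvgM => //; exact: cvg_cst.
  by apply/funext => n; rewrite mulr_sumr -big_split.
Qed.

Lemma uniform_sum_variance_ge S a b n : is_uniform_sum a b S ->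
  (S : T -> R) \in Lfun P 2%:E ->
  ((\sum_(0 <= k < n) (b k - a k) ^+ 2 / 12)%:E <= 'V_P[S])%E.
Proof.
move=> [X [iX uX cX]] S2.
have X2 k : (X k : T -> R) \in Lfun P 2%:E := uniform_on_Lfun2 (uX k).
have Sn2 := Lfun2_partial_sum n X2.
have -> : (S : T -> R) = partial_sum X n \+ (S \- partial_sum X n).
  by apply/funext => w /=; rewrite addrC subrK.
rewrite variance_independentD//.
- rewrite variance_partial_sum// -sumEFin.
  under [X in (X <= _)%E]eq_bigr do rewrite -(uniform_on_variance (uX _)).
  by rewrite leeDl// variance_ge0.
- exact: partial_sum_remainder_independent.
- by rewrite rpredB ?lee1n.
Qed.

Lemma uniform_sum_cvg_series S a b : is_uniform_sum a b S ->
  (S : T -> R) \in Lfun P 2%:E -> cvgn (series (fun k => (b k - a k) ^+ 2)).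
Proof.
move=> uS S2; apply: nondecreasing_is_cvgn.
  by apply: nondecreasing_series => k _ _; exact: sqr_ge0.
exists (fine 'V_P[S] * 12) => _ [n _ <-].
rewrite -ler_pdivrMr// mulr_suml -lee_fin fineK ?variance_fin_num//.
exact: uniform_sum_variance_ge.
Qed.

Lemma centered_uniform_independent X t : mutually_independent X ->
  (forall k, uniform_on (- (t k / 2)) (t k / 2) (X k)) ->
  centered_independent X (fun k => t k ^+ 2 / 12).
Proof.
move=> iX uX; split=> // k; first exact: uniform_on_Lfun2 (uX k).
  by rewrite (uniform_on_expectation (uX k)) addNr mul0r.
by rewrite (uniform_on_variance (uX k)) opprK -splitr.
Qed.

Lemma cvg_series_uniform_variance t : cvgn (series (fun k => t k ^+ 2)) ->
  cvgn (series (fun k => t k ^+ 2 / 12)).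
Proof.
move=> ct; rewrite (_ : (fun k => _) = 12^-1 *: (fun k => t k ^+ 2)).
  exact: is_cvg_seriesZ.
by apply/funext => k; rewrite fctE mulrC.
Qed.

Lemma calS_scale t c S : 0 <= c -> is_calS t S ->
  is_calS (fun k => c * t k) (affine_RV c 0 S).
Proof.
move=> c0 /(uniform_sum_affine c0 (m := fun=> 0) (e := 0)).
rewrite (_ : series _ = fun=> 0); last first.
  by apply/funext => n; rewrite /series/= big1.
move=> /(_ (cvg_cst _)); rewrite /is_calS.
under eq_fun do rewrite addr0 mulrN mulrA.
by under [X in is_uniform_sum _ X]eq_fun do rewrite addr0 mulrA.
Qed.

Lemma calS_Lfun2 t S : l2_tilde t -> is_calS t S ->
  (S : T -> R) \in Lfun P 2%:E.
Proof.
move=> [_ _ ct] [X [iX uX cX]].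
exact: centered_sum_Lfun2 (centered_uniform_independent iX uX)
  (cvg_series_uniform_variance ct) cX.
Qed.

Lemma calS_expectation t S : l2_tilde t -> is_calS t S -> 'E_P[S]%E = 0%E.
Proof.
move=> [_ _ ct] [X [iX uX cX]].
exact: centered_sum_expectation (centered_uniform_independent iX uX)
  (cvg_series_uniform_variance ct) cX.
Qed.

Lemma calS_variance_gt0 t S : l2_tilde t -> is_calS t S -> t <> (fun=> 0) ->
  0 < fine 'V_P[S]%E.
Proof.
move=> lt cS tn0; have [_ t0 _] := lt.
have t00 : 0 < t 0%N.
  rewrite lt_neqAle t0 andbT; apply/eqP => t00; apply: tn0; apply/funext => k.
  by apply/eqP; rewrite eq_le t0 andbT t00 l2_tilde_nonincreasing.
have S2 := calS_Lfun2 lt cS.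
have := uniform_sum_variance_ge 1 cS S2.
rewrite big_nat1 opprK -splitr -[leRHS]fineK ?variance_fin_num// lee_fin.
by apply: lt_le_trans; rewrite divr_gt0// exprn_gt0.
Qed.

Lemma partial_sum_cos X t s z n : mutually_independent X ->
  (forall k, uniform_on (- (t k / 2)) (t k / 2) (X k)) ->
  ('E_P[(fun w => cos (s * partial_sum X n w + z))%R] =
   (cos z * sinc_product t s n)%:E)%E.
Proof.
move=> iX uX; pose cs y x : R := cos (s * x + y).
have mcs y : measurable_fun setT (cs y).
  apply: (measurableT_comp (continuous_measurable_fun (@continuous_cos R))).
  exact: measurable_affine.
have cs1 y x : `|cs y x| <= 1 by rewrite ler_norml cos_geN1 cos_le1.
rewrite /sinc_product; elim: n z => [|n IH] z.
  rewrite big_geq// mulr1 partial_sum0.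
  by under eq_fun do rewrite mulr0 add0r; rewrite expectation_cst.
have split_cos : (fun w => cos (s * partial_sum X n.+1 w + z)) =
    ((cs 0 \o partial_sum X n) \* (cs z \o X n)) \-
    ((cs (- (pi / 2)) \o partial_sum X n) \* (cs (z - pi / 2) \o X n)).
  apply/funext => w; rewrite partial_sumS /cs /= addr0 mulrDr -addrA cosD.
  by rewrite (addrA _ z) !cosBpihalf.
have Sn_X := partial_sum_independent n iX.
have bounded1 y y' :
    ((cs y \o partial_sum X n) \* (cs y' \o X n) : T -> R) \in Lfun P 1.
  apply: (bounded_Lfun1 P (M := 1)) => [|w].
    by apply: measurable_funM; exact: measurableT_comp.
  by rewrite normrM; apply: mulr_ile1 => //; exact: cs1.
rewrite split_cos expectationB//.
rewrite !(expectation_bounded_independentM Sn_X _ _ (cs1 _) (cs1 _))//.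
rewrite !IH !(centered_uniform_cos _ _ (uX n)) cos0 cosN cos_pihalf !mul0r.
by rewrite mul0e sube0 -EFinM mul1r big_nat_recr//=; congr EFin; ring.
Qed.

Lemma calS_cos t s S : is_calS t S ->
  sinc_product t s @ \oo --> fine 'E_P[(fun w => cos (s * S w))%R].
Proof.
move=> [X [iX uX cX]]; pose c x : R := cos (s * x).
have cc : continuous c.
  move=> x; apply: continuous_comp; last exact: continuous_cos.
  exact: mulrl_continuous.
have mc : measurable_fun setT c by exact: continuous_measurable_fun.
have c1 x : `|c x| <= 1 by rewrite ler_norml cos_geN1 cos_le1.
rewrite (_ : sinc_product t s = fun n => fine 'E_P[c \o partial_sum X n]).
  apply: fine_cvg; rewrite fineK; last first.
    apply: expectation_fin_num; apply: (bounded_Lfun1 P (M := 1)) => [|w].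
      exact: (measurableT_comp mc).
    exact: c1.
  apply: (expectation_bounded_cvg (M := 1)) => [n||n w|].
  - exact: (measurableT_comp mc).
  - exact: (measurableT_comp mc).
  - exact: c1.
  - by apply: filterS cX => w; apply: continuous_cvg; exact: cc.
apply/funext => n; have := partial_sum_cos s 0 n iX uX.
rewrite cos0 mul1r (_ : (fun w => _) = c \o partial_sum X n) => [->//|].
by apply/funext => w; rewrite addr0.
Qed.

(* The difference of the partial sums of the X_k and of the centered X_k is
   deterministic, so that it converges as soon as both converge somewhere. *)
Lemma uniform_sum_center a b S : is_uniform_sum a b S ->
  (S : T -> R) \in Lfun P 2%:E ->
  exists c S', is_calS (fun k => b k - a k) S' /\
    {ae P, forall w, S w = c + S' w}.
Proof.
move=> uS S2; have cl := uniform_sum_cvg_series uS S2.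
have [X [iX uX cX]] := uS; pose m k := (a k + b k) / 2.
pose Z k := affine_RV 1 (- m k) (X k).
have iZ : mutually_independent Z.
  apply: (mutually_independent_comp (g := fun k x => 1 * x - m k)) iX => //.
  by move=> k; exact: measurable_affine.
have uZ k : uniform_on (- ((b k - a k) / 2)) ((b k - a k) / 2) (Z k).
  have -> : - ((b k - a k) / 2) = 1 * a k - m k by rewrite /m; field.
  have -> : (b k - a k) / 2 = 1 * b k - m k by rewrite /m; field.
  exact: uniform_on_affine (uX k).
have [S' cS'] := centered_sum_exists (centered_uniform_independent iZ uZ)
  (cvg_series_uniform_variance cl).
have XZ w n : partial_sum X n w - partial_sum Z n w = series m n.
  by rewrite -sumrB; apply: eq_bigr => k _; rewrite affine_RVE; ring.
have cvg_m w : partial_sum X n w @[n --> \oo] --> S w ->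
    partial_sum Z n w @[n --> \oo] --> S' w -> series m @ \oo --> S w - S' w.
  by move=> cXw cZw; rewrite -(funext (XZ w)); exact: cvgB.
have [w0 [cX0 cZ0]] := ae_nonempty (filterI cX cS').
exists (S w0 - S' w0), S'; split; first by exists Z.
apply: filterS2 cX cS' => w cXw cZw; apply/eqP; rewrite -subr_eq; apply/eqP.
exact: cvg_unique (cvg_m w cXw cZw) (cvg_m w0 cX0 cZ0).
Qed.

Lemma calS_rearrange l S : (forall k, 0 <= l k) ->
  cvgn (series (fun k => l k ^+ 2)) -> is_calS l S ->
  exists t S', [/\ l2_tilde t, is_calS t S' & {ae P, forall w, S w = S' w}].
Proof.
move=> l0 cl [X [iX uX cX]].
have l_cvg0 : l @ \oo --> (0 : R).
  apply/cvgrPdist_lt => e e0; have e20 : 0 < e ^+ 2 by rewrite exprn_gt0.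
  have /cvgrPdist_lt /(_ _ e20) := cvg_series_cvg_0 cl.
  apply: filterS => k; rewrite !sub0r !normrN normrX => le2.
  by rewrite -(@ltr_pXn2r _ 2)// nnegrE ?normr_ge0// ltW.
have [r [rI rdec rhit]] := decreasing_rearrangement l0 l_cvg0.
have sqr_hit k : 0 < l k ^+ 2 -> exists n, r n = k.
  rewrite exprn_even_gt0//= => lk; apply: rhit.
  by rewrite lt_neqAle eq_sym lk l0.
have lt : l2_tilde (l \o r).
  split=> [//|k|]; first exact: l0.
  exact: cvgP (cvg_series_rearrangement (fun k => sqr_ge0 (l k)) cl rI sqr_hit).
have Xv := centered_uniform_independent iX uX.
have cv := cvg_series_uniform_variance cl.
have [_ _ ct] := lt; have [S' cS'] := centered_sum_exists
  (centered_independent_reindex rI Xv) (cvg_series_uniform_variance ct).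
exists (l \o r), S'; split=> //.
  exists (fun k => X (r k)); split=> //.
  - exact: mutually_independent_reindex.
  - by move=> k; exact: uX.
apply: (rearranged_sum_ae_eq Xv cv rI) cX cS' => k.
by rewrite pmulr_lgt0 ?invr_gt0//; exact: sqr_hit.
Qed.

Lemma uniform_sum_canonical_form a b S : is_uniform_sum a b S ->
  (S : T -> R) \in Lfun P 2%:E ->
  exists c t S', [/\ l2_tilde t, is_calS t S' &
    law P S = law P (fun w => c + S' w)].
Proof.
move=> uS S2; have cl := uniform_sum_cvg_series uS S2.
have l0 k : 0 <= b k - a k.
  by have [X [_ /(_ k)[ab _ _] _]] := uS; rewrite subr_ge0.
have [c [S0 [cS0 SE]]] := uniform_sum_center uS S2.
have [t [S' [lt cS' S0E]]] := calS_rearrange l0 cl cS0.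
exists c, t, S'; split=> //.
apply: law_ae_eq => //; first exact: measurable_funD.
by apply: filterS2 SE S0E => w -> ->.
Qed.

End uniform_sum.

(** * The law of c + S_t *)

Lemma calS_exists (R : realType) (t : nat -> R) : l2_tilde t ->
  exists (d : measure_display) (T : measurableType d) (P : probability T R)
    (S : {RV P >-> R}), is_calS t S.
Proof.
move=> [_ t0 ct]; have [X [iX uX]] := iid_uniform_exists R.
pose Y k := affine_RV (t k) (- (t k / 2)) (X k).
have iY : mutually_independent Y.
  apply: (mutually_independent_comp (g := fun k x => t k * x - t k / 2)) iX.
    by move=> k; exact: measurable_affine.
  by move=> k w.
have uY k : uniform_on (- (t k / 2)) (t k / 2) (Y k).
  rewrite -[X in uniform_on X](add0r (- (t k / 2))) -[X in X - _](mulr0 (t k)).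
  rewrite [X in uniform_on _ X](_ : _ = t k * 1 - t k / 2); last by field.
  exact: uniform_on_affine (uX k).
have [S cS] := centered_sum_exists (centered_uniform_independent iY uY)
  (cvg_series_uniform_variance ct).
by exists _, _, _, S, Y.
Qed.

Section two_calS.
Context (R : realType) (d d' : measure_display).
Context (T : measurableType d) (P : probability T R).
Context (T' : measurableType d') (Q : probability T' R).
Implicit Types (St : {RV P >-> R}) (Su : {RV Q >-> R}) (t u : nat -> R).

Lemma calS_law_inj t u St Su : l2_tilde t -> l2_tilde u -> is_calS t St ->
  is_calS u Su -> law P St = law Q Su -> t = u.
Proof.
move=> lt lu cSt cSu St_Su.
pose phi s := fine 'E_P[(fun w => cos (s * St w))%R]%E.
apply: (sinc_product_lim_inj (phi := phi) lt lu) => s; first exact: calS_cos.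
have mcos : measurable_fun setT (fun x => (cos (s * x))%:E).
  apply/measurable_EFinP; apply: measurableT_comp; last exact: measurable_funM.
  exact: (continuous_measurable_fun (@continuous_cos R)).
rewrite /phi (_ : 'E_P[_]%E = 'E_Q[(fun w => cos (s * Su w))%R]%E).
  exact: calS_cos.
by rewrite unlock; exact: (integral_law mcos).
Qed.

Lemma shifted_calS_law_inj c c' t u St Su : l2_tilde t -> l2_tilde u ->
  is_calS t St -> is_calS u Su ->
  law P (fun w => c + St w) = law Q (fun w => c' + Su w) -> c = c' /\ t = u.
Proof.
move=> lt lu cSt cSu shift_law.
have St1 := Lfun2_Lfun1 (calS_Lfun2 lt cSt).
have Su1 := Lfun2_Lfun1 (calS_Lfun2 lu cSu).
have cc' : c = c'.
  have := expectation_law (X := cst c \+ St) (Y := cst c' \+ Su) shift_law.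
  rewrite !expectationD ?Lfun_cst// !expectation_cst.
  by rewrite (calS_expectation lt cSt) (calS_expectation lu cSu) !adde0 => -[].
split=> //; apply: (calS_law_inj lt lu cSt cSu).
have subr_measurable : measurable_fun setT (fun x : R => x - c).
  exact: measurable_funB.
have unshift (U : Type) (X : U -> R) :
    (fun x => x - c) \o (fun w => c + X w) = X.
  by apply/funext => w /=; rewrite addrAC subrr add0r.
by have := law_comp subr_measurable shift_law; rewrite -cc' !unshift.
Qed.

Lemma standardize_law (X : {RV P >-> R}) (Y : {RV Q >-> R}) :
  law P X = law Q Y -> law P (standardize P X) = law Q (standardize Q Y).
Proof.
move=> XY; rewrite /standardize (expectation_law XY) (variance_law XY).
set m := fine _; set s := Num.sqrt _.
apply: (law_comp (g := fun x => (x - m) / s)) XY.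
by apply: measurable_funM => //; exact: measurable_funB.
Qed.

End two_calS.

Section shifted_calS.
Context (R : realType) (d : measure_display) (T : measurableType d).
Context (P : probability T R).
Implicit Types (X S : {RV P >-> R}) (t : nat -> R) (c e : R).

Lemma shifted_calS_lawE c t S : is_calS t S ->
  shifted_calS_law c t = law P (fun w => c + S w).
Proof.
move=> cS; have lawsE : shifted_calS_laws c t = [set law P (fun w => c + S w)].
  apply/seteqP; split=> [_ [d' [T' [P' [S' [cS' ->]]]]]|_ ->]; last first.
    by exists d, T, P, S.
  apply: (law_comp (g := fun x => c + x)) (uniform_sum_law_eq cS' cS).
  exact: measurable_funD.
rewrite /shifted_calS_law lawsE; apply: xget_unique => //= m.
by move=> /seteqP[_ /(_ m erefl)].
Qed.

Lemma shifted_calS_generalized c t S : l2_tilde t -> is_calS t S ->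
  generalized_uniform_sum_laws (law P (fun w => c + S w)).
Proof.
move=> lt cS; pose m k : R := if k is 0%N then c else 0.
have cm : series m @ \oo --> c.
  rewrite -cvg_shiftS (_ : (fun n => _) = fun=> c); first exact: cvg_cst.
  by apply/funext => n; rewrite /series/= big_nat_recl// big1 ?addr0.
have S2 := Lfun2_affine 1 c (calS_Lfun2 lt cS).
exists d, T, P, (fun k => 1 * - (t k / 2) + m k).
exists (fun k => 1 * (t k / 2) + m k).
exists (affine_RV 1 c S); split.
- exact: uniform_sum_affine cm cS.
- exact/Lfun1_integrable/Lfun2_Lfun1.
- by rewrite -ge0_fin_numE ?variance_ge0// variance_fin_num.
- by congr law; apply/funext => w; rewrite affine_RVE mul1r addrC.
Qed.

Lemma standardize_affine c e X : 0 < c -> (X : T -> R) \in Lfun P 2%:E ->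
  standardize P (affine_RV c e X) = standardize P X.
Proof.
move=> c0 X2; have X1 := Lfun2_Lfun1 X2; apply/funext => w.
rewrite /standardize expectation_affine// variance_affine// affine_RVE.
rewrite fineD ?fin_numM ?expectation_fin_num// !fineM ?expectation_fin_num//.
  rewrite /= sqrtrM ?sqr_ge0// sqrtr_sqr gtr0_norm// opprD addrACA subrr addr0.
  by rewrite -mulrBr invfM mulrACA divff ?mul1r// gt_eqF.
exact: variance_fin_num.
Qed.

Lemma standardize_calS t S : l2_tilde t -> is_calS t S ->
  standardize P S = affine_RV (Num.sqrt (fine 'V_P[S]%E))^-1 0 S.
Proof.
move=> lt cS; apply/funext => w.
by rewrite /standardize (calS_expectation lt cS) subr0 affine_RVE addr0 mulrC.
Qed.

End shifted_calS.

Lemma l2_tilde_scale (R : realType) (t : nat -> R) (c : R) :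
  0 <= c -> l2_tilde t -> l2_tilde (fun k => c * t k).
Proof.
move=> c0 [dt t0 ct]; split=> [k|k|]; [exact: ler_wpM2l|exact: mulr_ge0|].
rewrite (_ : (fun k => _) = c ^+ 2 *: (fun k => t k ^+ 2)).
  exact: is_cvg_seriesZ.
by apply/funext => k; rewrite exprMn.
Qed.

Lemma standardized_calS_law_eqP (R : realType) (d d' : measure_display)
    (T : measurableType d) (P : probability T R)
    (T' : measurableType d') (Q : probability T' R)
    (S : {RV P >-> R}) (S' : {RV Q >-> R}) (t u : nat -> R) :
  l2_tilde t -> l2_tilde u -> t <> (fun=> 0) -> u <> (fun=> 0) ->
  is_calS t S -> is_calS u S' ->
  law P (standardize P S) = law Q (standardize Q S') <->
  exists lambda : R, u = (fun k => lambda * t k).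
Proof.
move=> lt lu t_neq0 u_neq0 cS cS'; split.
  set s := Num.sqrt (fine 'V_P[S]%E); set s' := Num.sqrt (fine 'V_Q[S']%E).
  have s0 : 0 <= s^-1 by rewrite invr_ge0 sqrtr_ge0.
  have s'0 : 0 < s' by rewrite sqrtr_gt0 (calS_variance_gt0 lu cS').
  have s'V0 : 0 <= s'^-1 by rewrite invr_ge0 ltW.
  rewrite (standardize_calS lt cS) (standardize_calS lu cS').
  move=> /(calS_law_inj (l2_tilde_scale s0 lt) (l2_tilde_scale s'V0 lu)
    (calS_scale s0 cS) (calS_scale s'V0 cS')) tu.
  exists (s' / s); apply/funext => k.
  by rewrite -mulrA (congr1 (@^~ k) tu) mulVKf// gt_eqF.
move=> [c uE]; have [[_ t0 _] [_ u0 _]] := (lt, lu).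
have c0 : 0 < c.
  rewrite ltNge; apply/negP => c0; apply: u_neq0; apply/funext => k.
  by apply/eqP; rewrite eq_le u0 andbT uE mulr_le0_ge0.
rewrite -(standardize_affine 0 c0 (calS_Lfun2 lt cS)); apply: standardize_law.
by apply: uniform_sum_law_eq (calS_scale (ltW c0) cS) _; move: cS'; rewrite uE.
Qed.

Theorem theorem3p13 (R : realType) :
  [/\ set_bij ([set: R] `*` @l2_tilde R) (@generalized_uniform_sum_laws R)
        (fun ct : R * (nat -> R) => shifted_calS_law ct.1 ct.2),
      forall t u : nat -> R, l2_tilde t -> l2_tilde u -> t <> u ->
        forall (d : measure_display) (T : measurableType d)
          (P : probability T R) (St : {RV P >-> R})
          (d' : measure_display) (T' : measurableType d')
          (Q : probability T' R) (Su : {RV Q >-> R}),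
          is_calS t St -> is_calS u Su -> law P St <> law Q Su &
      forall t u : nat -> R, l2_tilde t -> l2_tilde u ->
        t <> (fun=> 0) -> u <> (fun=> 0) ->
        forall (d : measure_display) (T : measurableType d)
          (P : probability T R) (St : {RV P >-> R})
          (d' : measure_display) (T' : measurableType d')
          (Q : probability T' R) (Su : {RV Q >-> R}),
          is_calS t St -> is_calS u Su ->
          (law P (standardize P St) = law Q (standardize Q Su) <->
           exists lambda : R, u = (fun k => lambda * t k))].
Proof.
split; last by move=> *; exact: standardized_calS_law_eqP.
- split=> [[c t] [_ /= lt]|[c t] [c' u] /set_mem[_ /= lt] /set_mem[_ /= lu]|].
  + have [d [T [P [S cS]]]] := calS_exists lt.
    by rewrite (shifted_calS_lawE c cS); exact: shifted_calS_generalized lt cS.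
  + have [d [T [P [S cS]]]] := calS_exists lt.
    have [d' [T' [Q [S' cS']]]] := calS_exists lu.
    rewrite (shifted_calS_lawE c cS) (shifted_calS_lawE c' cS').
    by move=> /(shifted_calS_law_inj lt lu cS cS')[-> ->].
  + move=> _ [d [T [P [a [b [S [uS S1 Voo ->]]]]]]].
    have S2 : (S : T -> R) \in Lfun P 2%:E.
      by apply: finite_variance_Lfun2 => //; exact/Lfun1_integrable.
    have [c [t [S' [lt cS' ->]]]] := uniform_sum_canonical_form uS S2.
    by exists (c, t) => //=; exact: shifted_calS_lawE.
- move=> t u lt lu t_neq_u d T P St d' T' Q Su cSt cSu eq_law; apply: t_neq_u.
  exact: calS_law_inj cSt cSu eq_law.
Qed.
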